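(* For every integer $d \geqslant 0$ there exist a constant $c_d \geqslant 1$ and an algorithm which, given an $n$-vertex graph $G$ together with a $d$-sequence of $G$, outputs an independent set of $G$ of size at least $\alpha(G)/c_d$, where $\alpha(G)$ is the maximum size of an independent set of $G$, and runs in time $2^{O_d(\sqrt n)}$. In other words, on $n$-vertex graphs given with a $d$-sequence, \textsc{Max Independent Set} can be $O_d(1)$-approximated in time $2^{O_d(\sqrt n)}$.
   Context: A trigraph consists of a vertex set together with two disjoint sets of unordered pairs of vertices: black edges and red edges. Contracting two (not necessarily adjacent) vertices $u,v$ of a trigraph into a new vertex $w$ produces the trigraph in which, for every other vertex $z$, $wz$ is a black edge if $uz$ and $vz$ were both black edges, $wz$ is a non-edge if $uz$ and $vz$ were both neither black nor red edges, and $wz$ is a red edge otherwise; all other adjacencies are unchanged. A graph is a trigraph with no red edge. A $d$-sequence of an $n$-vertex graph $G$ is a sequence of trigraphs $G=G_n, G_{n-1},\ldots,G_1$ where $G_1$ has one vertex, each $G_i$ is obtained from $G_{i+1}$ by one contraction, and in every $G_i$ every vertex is incident to at most $d$ red edges. The twin-width of $G$ is the least $d$ such that $G$ admits a $d$-sequence. The notation $O_d(\cdot)$ hides constants depending only on $d$. *)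

(* Defs.v *)
From Stdlib Require Export Reals.
From mathcomp Require Export all_boot.

Set Implicit Arguments.
Unset Strict Implicit.
Unset Printing Implicit Defensive.

(* MathComp takes the key R for ring_scope. *)
Delimit Scope R_scope with coqR.

(* Vertices of a trigraph are named by elements of a finite type T of labels,
   so that all the trigraphs of a contraction sequence live over the same T
   and an uncontracted vertex keeps its name. An edge is a two-element set. *)

Record trigraph (T : finType) := Trigraph {
  vertices : {set T};
  black_edges : {set {set T}};
  red_edges : {set {set T}};
  trigraph_edgeP : [forall e in black_edges :|: red_edges,
                      (#|e| == 2) && (e \subset vertices)];
  trigraph_disjointP : [disjoint black_edges & red_edges]
}.

Section Trigraph.
Variable T : finType.
Implicit Types (G H : trigraph T) (S : {set T}) (u v w x y z : T).

Definition black G x y : bool := [set x; y] \in black_edges G.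
Definition red_adj G x y : bool := [set x; y] \in red_edges G.
Definition nonadj G x y : bool := ~~ black G x y && ~~ red_adj G x y.

Definition is_graph G : bool := red_edges G == set0.

(* H is obtained from G by contracting u and v into the new vertex w. *)
Definition contraction u v w G H : bool :=
  let U := vertices G :\: [set u; v] in
  [&& u \in vertices G, v \in vertices G, u != v, w \notin vertices G,
      vertices H == w |: U,
      [forall x in U, forall y in U,
         (black H x y == black G x y) && (red_adj H x y == red_adj G x y)]
    & [forall z in U,
         let both_black := black G u z && black G v z in
         let both_non := nonadj G u z && nonadj G v z in
         [&& black H w z == both_black,
             nonadj H w z == both_non
           & red_adj H w z == ~~ both_black && ~~ both_non]]].

Definition contracts_to G H : bool :=
  [exists u, exists v, exists w, contraction u v w G H].

Definition red_degree G x : nat := #|[set e in red_edges G | x \in e]|.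

Definition red_degree_le d G : bool :=
  [forall x in vertices G, red_degree G x <= d].

(* The d-sequence is G :: s; its length is the number of vertices of G, since
   every contraction decreases the number of vertices by one. *)
Definition d_sequence (d : nat) G (s : seq (trigraph T)) : bool :=
  [&& path contracts_to G s, #|vertices (last G s)| == 1
    & all (red_degree_le d) (G :: s)].

(* Only meant for graphs: red edges are ignored. *)
Definition independent G S : bool :=
  (S \subset vertices G) && [forall x in S, forall y in S, ~~ black G x y].

Definition alpha G : nat := \max_(S : {set T} | independent G S) #|S|.

End Trigraph.

(* Model of computation: first-order call-by-value functional programs over
   binary trees (pure LISP without destructive updates).  A program is a list
   of function bodies, called by their position in the list; the argument of
   the main function, at position 0, is the input.  Functions have one
   argument, which may be a tuple built with [Cons].  There is no equality
   test on trees, and no operation copies or inspects a tree beyond its root,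
   so that each evaluation step takes constant time on a pointer machine or
   RAM.  Conversely, Turing machines and (logarithmic-cost) RAMs are simulated
   with polynomial overhead, so 2^O(sqrt n) means the same in all of them. *)

Inductive tree := Leaf | Node of tree & tree.

Inductive expr :=
| Var of nat                   (* de Bruijn index into the environment *)
| Nil
| Cons of expr & expr
| Let of expr & expr           (* binds index 0 in the second expression *)
| Case of expr & expr & expr   (* the branch for [Node a b] binds a and b
                                  as the indices 0 and 1 *)
| Call of nat & expr.

Definition program := seq expr.

(* [eval P env e r t]: in the environment env, e evaluates to r in t steps. *)
Inductive eval (P : program) : seq tree -> expr -> tree -> nat -> Prop :=
| EvalVar env i :
    eval P env (Var i) (nth Leaf env i) 1
| EvalNil env :
    eval P env Nil Leaf 1
| EvalCons env e1 e2 a b t1 t2 :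
    eval P env e1 a t1 -> eval P env e2 b t2 ->
    eval P env (Cons e1 e2) (Node a b) (t1 + t2).+1
| EvalLet env e1 e2 a r t1 t2 :
    eval P env e1 a t1 -> eval P (a :: env) e2 r t2 ->
    eval P env (Let e1 e2) r (t1 + t2).+1
| EvalCaseLeaf env e e1 e2 r t1 t2 :
    eval P env e Leaf t1 -> eval P env e1 r t2 ->
    eval P env (Case e e1 e2) r (t1 + t2).+1
| EvalCaseNode env e e1 e2 a b r t1 t2 :
    eval P env e (Node a b) t1 -> eval P (a :: b :: env) e2 r t2 ->
    eval P env (Case e e1 e2) r (t1 + t2).+1
| EvalCall env f e a r t1 t2 :
    eval P env e a t1 -> eval P [:: a] (nth Nil P f) r t2 ->
    eval P env (Call f e) r (t1 + t2).+1.

Definition computes_in (P : program) (input output : tree) (t : nat) : Prop :=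
  eval P [:: input] (nth Nil P 0) output t.

(* Numbers are encoded in unary; as the labels used below are less than 2n,
   this keeps the size of the input polynomial in n. *)
Definition enc_nat (k : nat) : tree := iter k (Node Leaf) Leaf.

Definition enc_seq (A : Type) (enc : A -> tree) (s : seq A) : tree :=
  foldr (fun a r => Node (enc a) r) Leaf s.

Definition enc_label (N : nat) (x : 'I_N) : tree := enc_nat x.

Definition enc_set (T : finType) (enc : T -> tree) (A : {set T}) : tree :=
  enc_seq enc (enum A).

Definition enc_trigraph (N : nat) (G : trigraph 'I_N) : tree :=
  let enc_edges := enc_set (enc_set (@enc_label N)) in
  Node (enc_set (@enc_label N) (vertices G))
       (Node (enc_edges (black_edges G)) (enc_edges (red_edges G))).

(* The encoding of G together with the rest s of its contraction sequence. *)
Definition enc_input (N : nat) (G : trigraph 'I_N) (s : seq (trigraph 'I_N)) :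
    tree :=
  Node (enc_trigraph G) (enc_seq (@enc_trigraph N) s).

(* The output lists the elements of S, without repetition, in any order. *)
Definition represents_set (N : nat) (r : tree) (S : {set 'I_N}) : Prop :=
  exists2 l : seq 'I_N, perm_eq l (enum S) & r = enc_seq (@enc_label N) l.

(* Main.v *)
From Stdlib Require Import Lra.
From mathcomp Require Import zify.
Require Import Defs.

Set Implicit Arguments.
Unset Strict Implicit.
Unset Printing Implicit Defensive.

(* Follow the contraction sequence and let every part x carry an open set,
   initially {x}.  When u and v are contracted, their open sets are merged if
   the union has at most r elements, where r is about sqrt (2 n); otherwise
   both are closed and become clusters, and the new part gets an empty open
   set.  Closing two clusters uses up more than r vertices, so there are at
   most r + 1 clusters, each of size at most r.

   Call two clusters A, B good if for every edge ab between them a is complete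
   to B or b is complete to A.  When u is closed, every vertex of a cluster
   closed later lies in the open set of some current part q, and is homogeneous
   to the open set of u unless uq is red.  Hence the clusters that are closed
   after the one of u and not good with it can be reached through at most d
   parts q, and colouring the clusters greedily from the last one to the first
   gives d + 1 classes of pairwise good clusters.  One class contains a
   1/(d + 1) fraction of an optimal independent set.

   The algorithm does not compute the colouring but tries every set H of
   clusters.  A vertex survives H if it is complete to no member of H.  If the
   members of H are pairwise good, there is no edge between survivors of
   different members, so maximum independent sets of survivors, found by brute
   force in each member, can be united; and if an independent set meets every
   member of H, then all of its vertices survive. *)

(** * The program and its evaluation *)

(* These macros expect a single tuple in the environment. Under [Unpack2] the
   components of (a, b) are the variables 0, 1; under [Unpack3] those of
   (a, (b, c)) are 2, 0, 1.  The comment above each function body shows its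
   argument: [V] is a list of vertices, [E] a list of edges, [parts] a list of
   pairs (part, open set), [H] and [Hs] are lists of clusters. *)
Definition Unpack2 e := Case (Var 0) Nil e.
Definition Unpack3 e := Case (Var 0) Nil (Case (Var 1) Nil e).
Definition Tuple3 e1 e2 e3 := Cons e1 (Cons e2 e3).
Definition True_ := Cons Nil Nil.

Definition f_eq := 1.
Definition f_mem := 2.
Definition f_all_mem := 3.
Definition f_indep := 4.
Definition f_has_nonadj := 5.
Definition f_survives := 6.
Definition f_survivors := 7.
Definition f_shorter := 8.
Definition f_longer := 9.
Definition f_cat := 10.
Definition f_if_indep := 11.
Definition f_max_indep := 12.
Definition f_combine := 13.
Definition f_candidate := 14.
Definition f_best := 15.
Definition f_drop := 16.
Definition f_sqrt := 17.
Definition f_gone := 18.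
Definition f_lookup := 19.
Definition f_new_parts := 20.
Definition f_init := 21.
Definition f_flatten := 22.
Definition f_clusters := 23.

(* (a, b) *)
Definition b_eq := Unpack2
  (Case (Var 0) (Case (Var 1) True_ Nil)
     (Case (Var 3) Nil (Call f_eq (Cons (Var 3) (Var 1))))).

(* (x, l) *)
Definition b_mem := Unpack2
  (Case (Var 1) Nil
     (Case (Call f_eq (Cons (Var 2) (Var 0)))
        (Call f_mem (Cons (Var 2) (Var 1)))
        True_)).

(* (e, l) *)
Definition b_all_mem := Unpack2
  (Case (Var 0) True_
     (Case (Call f_mem (Cons (Var 0) (Var 3)))
        Nil
        (Call f_all_mem (Cons (Var 3) (Var 5))))).

(* (l, E) *)
Definition b_indep := Unpack2
  (Case (Var 1) True_
     (Case (Call f_all_mem (Cons (Var 0) (Var 2)))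
        (Call f_indep (Cons (Var 2) (Var 1)))
        Nil)).

(* (v, (A, E)) *)
Definition b_has_nonadj := Unpack3
  (Case (Var 0) Nil
     (Case (Call f_indep (Cons (Tuple3 (Var 4) (Var 0) Nil) (Var 3)))
        (Call f_has_nonadj (Tuple3 (Var 4) (Var 1) (Var 3)))
        True_)).

(* (v, (H, E)) *)
Definition b_survives := Unpack3
  (Case (Var 0) True_
     (Case (Call f_has_nonadj (Tuple3 (Var 4) (Var 0) (Var 3)))
        Nil
        (Call f_survives (Tuple3 (Var 6) (Var 3) (Var 5))))).

(* (A, (H, E)) *)
Definition b_survivors := Unpack3
  (Case (Var 2) Nil
     (Let (Call f_survivors (Tuple3 (Var 1) (Var 2) (Var 3)))
        (Case (Call f_survives (Tuple3 (Var 1) (Var 3) (Var 4)))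
           (Var 0)
           (Cons (Var 3) (Var 2))))).

(* (a, b) *)
Definition b_shorter := Unpack2
  (Case (Var 0) True_
     (Case (Var 3) Nil (Call f_shorter (Cons (Var 3) (Var 1))))).

(* (a, b) *)
Definition b_longer := Unpack2
  (Case (Call f_shorter (Cons (Var 0) (Var 1))) (Var 0) (Var 3)).

(* (a, b) *)
Definition b_cat := Unpack2
  (Case (Var 0) (Var 1) (Cons (Var 0) (Call f_cat (Cons (Var 1) (Var 3))))).

(* (l, E) *)
Definition b_if_indep := Unpack2
  (Case (Call f_indep (Cons (Var 0) (Var 1))) Nil (Var 2)).

(* (rest, (chosen, E)) *)
Definition b_search self cand := Unpack3
  (Case (Var 2) (Call cand (Cons (Var 0) (Var 1)))
     (Call f_longer
        (Cons (Call self (Tuple3 (Var 1) (Cons (Var 0) (Var 2)) (Var 3)))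
              (Call self (Tuple3 (Var 1) (Var 2) (Var 3)))))).

(* (Hs, (H, E)) *)
Definition b_combine := Unpack3
  (Case (Var 2) Nil
     (Call f_cat
        (Cons (Call f_max_indep
                 (Tuple3 (Call f_survivors (Tuple3 (Var 0) (Var 2) (Var 3)))
                    Nil (Var 3)))
              (Call f_combine (Tuple3 (Var 1) (Var 2) (Var 3)))))).

(* (H, E) *)
Definition b_candidate := Unpack2
  (Call f_if_indep
     (Cons (Call f_combine (Tuple3 (Var 0) (Var 0) (Var 1))) (Var 1))).

(* (k, l) *)
Definition b_drop := Unpack2
  (Case (Var 0) (Var 1)
     (Case (Var 3) Nil (Call f_drop (Cons (Var 3) (Var 1))))).

(* (k, l) *)
Definition b_sqrt := Unpack2
  (Case (Var 1) (Var 0)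
     (Call f_sqrt (Cons (Cons Nil (Var 2)) (Call f_drop (Cons (Var 2) (Var 1)))))).

(* (parts, V) *)
Definition b_gone := Unpack2
  (Case (Var 0) Nil
     (Let (Call f_gone (Cons (Var 1) (Var 3)))
        (Case (Var 1) Nil
           (Case (Call f_mem (Cons (Var 0) (Var 6)))
              (Cons (Var 1) (Var 2))
              (Var 4))))).

(* (x, (parts, default)) *)
Definition b_lookup := Unpack3
  (Case (Var 0) (Var 1)
     (Case (Var 0) Nil
        (Case (Call f_eq (Cons (Var 6) (Var 0)))
           (Call f_lookup (Tuple3 (Var 6) (Var 3) (Var 5)))
           (Var 3)))).

(* (V, (parts, default)) *)
Definition b_new_parts := Unpack3
  (Case (Var 2) Nil
     (Cons (Cons (Var 0) (Call f_lookup (Tuple3 (Var 0) (Var 2) (Var 3))))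
           (Call f_new_parts (Tuple3 (Var 1) (Var 2) (Var 3))))).

(* V *)
Definition b_init :=
  Case (Var 0) Nil
    (Cons (Tuple3 (Var 0) (Var 0) Nil) (Call f_init (Var 1))).

(* ll *)
Definition b_flatten :=
  Case (Var 0) Nil (Call f_cat (Cons (Var 0) (Call f_flatten (Var 1)))).

(* (threshold, (parts, trigraphs)) *)
Definition b_clusters := Unpack3
  (Case (Var 1) (Call f_gone (Cons (Var 0) Nil))
     (Case (Var 0) Nil
        (Let (Call f_gone (Cons (Var 4) (Var 0)))
           (Let (Call f_flatten (Var 0))
              (Case (Call f_shorter (Cons (Var 0) (Var 8)))
                 (Call f_cat (Cons (Var 1)
                    (Call f_clusters (Tuple3 (Var 8)
                       (Call f_new_parts (Tuple3 (Var 2) (Var 6) Nil))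
                       (Var 5)))))
                 (Call f_clusters (Tuple3 (Var 10)
                    (Call f_new_parts (Tuple3 (Var 4) (Var 8) (Var 2)))
                    (Var 7)))))))).

(* ((V, (B, R)), trigraphs) *)
Definition b_main :=
  Case (Var 0) Nil
    (Case (Var 0) Nil
       (Case (Var 1) Nil
          (Call f_best
             (Tuple3
                (Call f_clusters
                   (Tuple3 (Call f_sqrt (Cons Nil (Var 2)))
                           (Call f_init (Var 2))
                           (Var 5)))
                Nil (Var 0))))).

Definition prog : program :=
  [:: b_main; b_eq; b_mem; b_all_mem; b_indep; b_has_nonadj; b_survives;
      b_survivors; b_shorter; b_longer; b_cat; b_if_indep;
      b_search f_max_indep f_if_indep; b_combine; b_candidate;
      b_search f_best f_candidate; b_drop; b_sqrt; b_gone; b_lookup;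
      b_new_parts; b_init; b_flatten; b_clusters].

(** Costs are upper bounds from here on, so a function body only has to fit under a round figure. *)
Definition evalle env e r T := exists2 t, eval prog env e r t & t <= T.
Definition calls f a r T := evalle [:: a] (nth Nil prog f) r T.

Lemma evalle_weaken env e r T1 T2 :
  evalle env e r T1 -> T1 <= T2 -> evalle env e r T2.
Proof. by move=> [t ev_t le_t] le_T; exists t => //; apply: leq_trans le_T. Qed.

Lemma evalle_var env i r : nth Leaf env i = r -> evalle env (Var i) r 1.
Proof. by move<-; exists 1 => //; apply: EvalVar. Qed.

Lemma evalle_nil env : evalle env Nil Leaf 1.
Proof. by exists 1 => //; apply: EvalNil. Qed.

Lemma evalle_cons env e1 e2 a b T1 T2 :
  evalle env e1 a T1 -> evalle env e2 b T2 ->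
  evalle env (Cons e1 e2) (Node a b) (T1 + T2).+1.
Proof.
move=> [t1 ev1 le1] [t2 ev2 le2].
by exists (t1 + t2).+1; [apply: EvalCons | rewrite ltnS leq_add].
Qed.

Lemma evalle_let env e1 e2 a r T1 T2 :
  evalle env e1 a T1 -> evalle (a :: env) e2 r T2 ->
  evalle env (Let e1 e2) r (T1 + T2).+1.
Proof.
move=> [t1 ev1 le1] [t2 ev2 le2].
by exists (t1 + t2).+1; [apply: EvalLet ev1 ev2 | rewrite ltnS leq_add].
Qed.

Lemma evalle_case env e e1 e2 v r T1 T2 :
  evalle env e v T1 ->
  match v with
  | Leaf => evalle env e1 r T2
  | Node a b => evalle (a :: b :: env) e2 r T2
  end ->
  evalle env (Case e e1 e2) r (T1 + T2).+1.
Proof.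
case: v => [|a b] [t1 ev1 le1] [t2 ev2 le2]; exists (t1 + t2).+1;
  rewrite ?ltnS ?leq_add //.
- exact: EvalCaseLeaf ev1 ev2.
- exact: EvalCaseNode ev1 ev2.
Qed.

Lemma evalle_call env f e a r T1 T2 :
  evalle env e a T1 -> calls f a r T2 -> evalle env (Call f e) r (T1 + T2).+1.
Proof.
move=> [t1 ev1 le1] [t2 ev2 le2].
by exists (t1 + t2).+1; [apply: EvalCall ev1 ev2 | rewrite ltnS leq_add].
Qed.

Definition enc_bool (b : bool) : tree := if b then Node Leaf Leaf else Leaf.

(** Symbolic execution: the bound is an existential variable assembled along the expression, and
    each call is closed by a [calls] hypothesis that must already be in the context. After [run] an
    arithmetic inequality is left. *)
Ltac run_step :=
  lazymatch goal with
  | |- evalle ?env ?e ?r ?T =>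
    let e' := eval hnf in e in change (evalle env e' r T);
    lazymatch e' with
    | Var _ => apply: evalle_var; lazy beta iota delta [nth]; reflexivity
    | Nil => apply: evalle_nil
    | Cons _ _ => eapply evalle_cons; [run_step | run_step]
    | Let _ _ => eapply evalle_let; [run_step | run_step]
    | Case _ _ _ =>
        eapply evalle_case; [run_step | lazy beta iota delta [enc_bool]; run_step]
    | Call _ _ => eapply evalle_call; [run_step | eassumption]
    end
  end.

Ltac run :=
  rewrite /calls; apply: evalle_weaken; [run_step | ].

(** * What the program computes, and its cost *)

Lemma enc_seq_nil (A : Type) (enc : A -> tree) : enc_seq enc [::] = Leaf.
Proof. by []. Qed.

Lemma enc_seq_cons (A : Type) (enc : A -> tree) x s :
  enc_seq enc (x :: s) = Node (enc x) (enc_seq enc s).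
Proof. by []. Qed.

Lemma enc_natS k : enc_nat k.+1 = Node Leaf (enc_nat k).
Proof. by []. Qed.

Lemma enc_nat0 : enc_nat 0 = Leaf.
Proof. by []. Qed.

Definition enc_simp := (enc_seq_nil, enc_seq_cons, enc_nat0, enc_natS).

(** Lists and unary numbers share this measure, so one comparison serves for two lists and for a
    list against the threshold. *)
Fixpoint spine (t : tree) : nat := if t is Node _ t' then (spine t').+1 else 0.

Lemma spine_nat k : spine (enc_nat k) = k.
Proof. by elim: k => //= k ->. Qed.

Lemma spine_seq (A : Type) (enc : A -> tree) s : spine (enc_seq enc s) = size s.
Proof. by elim: s => //= x s ->. Qed.

Fixpoint drop_spine (k : nat) (t : tree) : tree :=
  match k, t with
  | k'.+1, Node _ t' => drop_spine k' t'
  | _, _ => t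
  end.

Lemma spine_drop k t : spine (drop_spine k t) = spine t - k.
Proof. by elim: k t => [|k IH] [|a t] //=; rewrite ?subn0 // IH subSS. Qed.

Definition longer (A : Type) (a b : seq A) := if size a <= size b then b else a.

Lemma enc_seq_map (A B : Type) (enc : B -> tree) (h : A -> B) s :
  enc_seq (fun a => enc (h a)) s = enc_seq enc (map h s).
Proof. by elim: s => //= a s ->. Qed.

(** * Exhaustive search over the subsequences of a list *)

Section Search.
Variables (A B : Type) (cand : seq A -> seq B).

Fixpoint search (rest chosen : seq A) : seq B :=
  if rest is x :: r then longer (search r (x :: chosen)) (search r chosen)
  else cand chosen.

(** The branch that follows [p] ends with [filter p rest] pushed onto [chosen] in reverse, whence
    [catrev], and [longer] never loses length. *)
Lemma search_ge (p : pred A) rest chosen :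
  size (cand (catrev (filter p rest) chosen)) <= size (search rest chosen).
Proof.
elim: rest chosen => //= x r IH chosen.
have le_longer s1 s2 :
    size s1 <= size (@longer B s1 s2) /\ size s2 <= size (longer s1 s2).
  by rewrite /longer; case: ifP => // /negbT; rewrite -ltnNge => /ltnW.
by case: (p x); [have [le _] := le_longer (search r (x :: chosen)) (search r chosen)
                | have [_ le] := le_longer (search r (x :: chosen)) (search r chosen)];
  apply: leq_trans le; apply: IH.
Qed.

(** The result is the candidate of some branch, and a branch amounts to a mask on [rest]. *)
Lemma search_ind (Q : seq A -> Prop) (R : seq B -> Prop) :
  (forall ch, Q ch -> R (cand ch)) ->
  forall rest chosen,
  (forall m, Q (catrev (mask m rest) chosen)) -> R (search rest chosen).
Proof.
move=> QR; elim=> [|x r IH] chosen Qch /=; first by apply: QR; apply: (Qch [::]).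
rewrite /longer; case: ifP => _; apply: IH => m.
- exact: (Qch (false :: m)).
- exact: (Qch (true :: m)).
Qed.

End Search.

(** * The functions computed by the program *)

Section Semantics.
Variable T : eqType.
Implicit Types (E : seq (seq T)) (l A : seq T) (H : seq (seq T)) (v w x : T).
Implicit Types (ps : seq (T * seq T)) (V : seq T).

Definition indep E l := all (fun e => ~~ all (mem l) e) E.

(** Nonadjacency is tested as independence of a pair. As the edges of a graph have two ends, a
    vertex counts as nonadjacent to itself and is never eliminated by its own cluster. *)
Definition has_nonadj E A v := has (fun w => indep E [:: v; w]) A.

Definition survives E H v := all (fun A => has_nonadj E A v) H.

Definition if_indep E l := if indep E l then l else [::].

Definition max_indep E := search (if_indep E).

Definition combine E H Hs :=
  flatten [seq max_indep E (filter (survives E H) A) [::] | A <- Hs].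

(** If [H] is not pairwise good the union may contain an edge; the final test then replaces it by
    the empty list. *)
Definition candidate E H := if_indep E (combine E H H).

Definition best E := search (candidate E).

Definition gone ps V := [seq p.2 | p <- ps & p.1 \notin V].

Fixpoint lookup x ps (o : seq T) :=
  if ps is p :: ps' then if x == p.1 then p.2 else lookup x ps' o else o.

(** Along a contraction sequence, the only vertex of [V] without an entry in [ps] is the newly
    created one, so [o] becomes its open set. *)
Definition new_parts V ps o := [seq (x, lookup x ps o) | x <- V].

(** A contraction is recognised from the vertex lists alone: the parts missing from the next list
    are the contracted ones. At the end all remaining open sets are closed, since nothing lies in
    [[::]]. *)
Fixpoint clusters thr ps (Vs : seq (seq T)) : seq (seq T) :=
  if Vs is V :: Vs' then
    let g := gone ps V in
    let o := flatten g in
    if size o <= thr then clusters thr (new_parts V ps o) Vs'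
    else g ++ clusters thr (new_parts V ps [::]) Vs'
  else gone ps [::].

End Semantics.

(** Subtracts 1, 2, 3, ... from [l]: started at [k = 0] with enough fuel, it finds the least [k]
    with [k (k + 1) / 2 >= l]. The fuel makes the recursion structural; the program has no such
    argument. *)
Fixpoint sqrt_loop fuel (k l : nat) :=
  if fuel is m.+1 then if l is l'.+1 then sqrt_loop m k.+1 (l' - k) else k else k.

(** * Evaluation cost of each function *)

Section Cost.
Variables (N M : nat).
Hypothesis leNM : N <= M.
Local Notation et := (@enc_label N).
Local Notation el := (enc_seq et).
Local Notation ell := (enc_seq el).
Local Notation epart := (fun p : 'I_N * seq 'I_N => Node (et p.1) (el p.2)).
Local Notation eparts := (enc_seq epart).

(** Cost of a recursion on a list shorter than [M] whose calls to other functions cost [c] per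
    round; 60 absorbs the constant work of a round. *)
Definition loop_cost c := (c + 60) * M.

Lemma calls_loop f a r c k :
  calls f a r ((c + 60) * k.+1) -> k < M -> calls f a r (loop_cost c).
Proof. by move=> ca lt_k; apply: evalle_weaken ca _; rewrite leq_mul2l lt_k orbT. Qed.

Lemma calls_weaken f a r T1 T2 : calls f a r T1 -> T1 <= T2 -> calls f a r T2.
Proof. exact: evalle_weaken. Qed.

Definition c_eq := loop_cost 0.
Definition c_mem := loop_cost c_eq.
Definition c_all_mem := loop_cost c_mem.
Definition c_indep := loop_cost c_all_mem.
Definition c_has_nonadj := loop_cost c_indep.
Definition c_survives := loop_cost c_has_nonadj.
Definition c_survivors := loop_cost c_survives.

Lemma calls_eq (x y : 'I_N) :
  calls f_eq (Node (et x) (et y)) (enc_bool (x == y)) c_eq.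
Proof.
rewrite -val_eqE /= /enc_label; have := leq_trans (ltn_ord x) leNM.
apply: calls_loop; move: (nat_of_ord x) (nat_of_ord y) => {x y}.
elim=> [|x IH] [|y]; rewrite !enc_simp ?eqSS; last have ca := IH y.
all: by run; lia.
Qed.

Lemma calls_mem x l : size l < M ->
  calls f_mem (Node (et x) (el l)) (enc_bool (x \in l)) c_mem.
Proof.
apply: calls_loop; elim: l => [|y l IH]; rewrite !enc_simp; first by run; lia.
rewrite in_cons; have := calls_eq x y; case: (x == y) => ca /=; run; lia.
Qed.

Lemma calls_all_mem e l : size e < M -> size l < M ->
  calls f_all_mem (Node (el e) (el l)) (enc_bool (all (mem l) e)) c_all_mem.
Proof.
move=> lte ltl; apply: calls_loop lte.
elim: e => [|x e IH]; rewrite !enc_simp; first by run; lia.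
have /= := calls_mem x ltl; case: (x \in l) => ca /=; run; lia.
Qed.

Definition bounded_edges (E : seq (seq 'I_N)) :=
  (size E < M) && all (fun e => size e < M) E.

Lemma calls_indep l E : bounded_edges E -> size l < M ->
  calls f_indep (Node (el l) (ell E)) (enc_bool (indep E l)) c_indep.
Proof.
move=> /andP[ltE allE] ltl; apply: calls_loop ltE.
elim: E allE => [|e E IH]; rewrite !enc_simp => allE; first by run; lia.
move: allE => /= /andP[lte /IH{}IH].
have /= := calls_all_mem lte ltl; case: (all _ e) => ca /=; run; lia.
Qed.

Lemma calls_shorter a b :
  calls f_shorter (Node a b) (enc_bool (spine a <= spine b)) (60 * (spine a).+1).
Proof.
elim: a b => [|x _ a IH] [|y b] /=; [by run; lia | by run; lia | by run; lia | ].
have ca := IH b; rewrite ltnS; run; lia.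
Qed.

Lemma calls_longer a b : size a < M ->
  calls f_longer (Node (el a) (el b)) (el (longer a b)) (loop_cost 60).
Proof.
move=> lta; have := calls_shorter (el a) (el b); rewrite !spine_seq /longer.
case: (_ <= _) => ca; apply: calls_loop lta; run; lia.
Qed.

Lemma calls_cat (X : Type) (enc : X -> tree) a b : size a < M ->
  calls f_cat (Node (enc_seq enc a) (enc_seq enc b)) (enc_seq enc (a ++ b))
    (loop_cost 0).
Proof.
apply: calls_loop.
elim: a => [|x a IH]; rewrite ?cat_cons !enc_simp; first by run; lia.
by run; rewrite /=; lia.
Qed.

Section Edges.
Variable E : seq (seq 'I_N).
Hypothesis bndE : bounded_edges E.
Hypothesis lt2M : 2 < M.

Lemma calls_has_nonadj v A : size A < M ->
  calls f_has_nonadj (Node (et v) (Node (el A) (ell E)))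
    (enc_bool (has_nonadj E A v)) c_has_nonadj.
Proof.
apply: calls_loop; elim: A => [|w A IH]; rewrite !enc_simp; first by run; lia.
have := @calls_indep [:: v; w] E bndE lt2M; rewrite !enc_simp /=.
by case: (indep _ _) => ca /=; run; lia.
Qed.

Definition bounded_sets (H : seq (seq 'I_N)) :=
  (size H < M) && all (fun A => size A < M) H.

Lemma calls_survives v H : bounded_sets H ->
  calls f_survives (Node (et v) (Node (ell H) (ell E)))
    (enc_bool (survives E H v)) c_survives.
Proof.
move=> /andP[ltH allH]; apply: calls_loop ltH.
elim: H allH => [|A H IH]; rewrite !enc_simp; first by move=> _; run; lia.
move=> /= /andP[ltA /IH{}IH].
have := calls_has_nonadj v ltA; case: (has_nonadj _ _ _) => ca /=; run; lia.
Qed.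

Lemma calls_survivors A H : bounded_sets H -> size A < M ->
  calls f_survivors (Node (el A) (Node (ell H) (ell E)))
    (el (filter (survives E H) A)) c_survivors.
Proof.
move=> bndH; apply: calls_loop.
elim: A => [|v A IH]; rewrite !enc_simp; first by run; lia.
have := calls_survives v bndH; rewrite /=; case: (survives _ _ _) => ca; rewrite ?enc_simp; run; lia.
Qed.

Definition c_if_indep := c_indep + 60.

Lemma calls_if_indep l : size l < M ->
  calls f_if_indep (Node (el l) (ell E)) (el (if_indep E l)) c_if_indep.
Proof.
move=> ltl; rewrite /if_indep /c_if_indep.
have := calls_indep bndE ltl; case: (indep E l) => ca; run; lia.
Qed.

(** The recursion tree over [k] elements has fewer than [2 ^ k.+1] nodes, and each pays for at most
    one candidate and one comparison. *)
Definition search_cost c k := (c + loop_cost 60 + 60) * (2 ^ k.+1).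

Lemma calls_search (X : Type) (enc : X -> tree) self fcand (cand : seq X -> seq 'I_N)
    (p : pred X) m c :
  nth Nil prog self = b_search self fcand ->
  (forall ch, size ch <= m -> all p ch ->
     size (cand ch) < M /\
     calls fcand (Node (enc_seq enc ch) (ell E)) (el (cand ch)) c) ->
  forall rest ch, size rest + size ch <= m -> all p rest -> all p ch ->
  size (search cand rest ch) < M /\
  calls self (Node (enc_seq enc rest) (Node (enc_seq enc ch) (ell E)))
    (el (search cand rest ch)) (search_cost c (size rest)).
Proof.
move=> self_def cand_ok rest ch le_m all_rest all_ch.
(* The exact node count makes the induction close: two subtrees and their root give the count of the
   next level. *)
suff [lt ca]: size (search cand rest ch) < M /\
  calls self (Node (enc_seq enc rest) (Node (enc_seq enc ch) (ell E)))
    (el (search cand rest ch))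
    ((c + loop_cost 60 + 60) * (2 ^ (size rest).+1).-1).
  by split=> //; apply: calls_weaken ca _; rewrite leq_mul2l leq_pred orbT.
elim: rest ch le_m all_rest all_ch => [|x r IH] ch; rewrite !enc_simp.
  move=> le_m _ all_ch; have [lt ca] := cand_ok ch le_m all_ch; split=> //.
  rewrite /calls self_def; run; rewrite /=; lia.
move=> /= le_m /andP[px all_r] all_ch.
have [||lt1 ca1] := IH (x :: ch) _ all_r; rewrite /= ?addnS ?px //.
rewrite enc_seq_cons in ca1.
have [|lt2 ca2] := IH ch _ all_r all_ch; first exact: ltnW le_m.
split; first by rewrite /longer; case: ifP.
have ca3 := calls_longer (search cand r ch) lt1.
rewrite /calls self_def; run; rewrite [X in _ <= _ * X.-1]expnS.
move: (2 ^ _.+1) (expn_gt0 2 (size r).+1) => q; move: (loop_cost 60) => L; nia.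
Qed.

Definition c_max_indep k := search_cost c_if_indep k.

Lemma calls_max_indep rest : size rest < M ->
  calls f_max_indep (Node (el rest) (Node Leaf (ell E)))
    (el (max_indep E rest [::])) (c_max_indep (size rest)).
Proof.
move=> lt_rest.
have cand_ok ch : size ch <= size rest -> all predT ch ->
    size (if_indep E ch) < M /\
    calls f_if_indep (Node (el ch) (ell E)) (el (if_indep E ch)) c_if_indep.
  move=> le_ch _; have ltch := leq_ltn_trans le_ch lt_rest.
  split; last exact: calls_if_indep.
  by rewrite /if_indep; case: ifP => // _; apply: leq_ltn_trans ltch.
have le_rest : size rest + @size 'I_N [::] <= size rest by rewrite addn0.
by have [] := calls_search (erefl : nth Nil prog f_max_indep = _) cand_ok
  le_rest (all_predT _) (all_predT _).
Qed.

Lemma size_max_indep (A : seq 'I_N) : size (max_indep E A [::]) <= size A.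
Proof.
apply: (@search_ind _ _ (if_indep E) (fun ch => size ch <= size A)
  (fun r => size r <= size A)).
- by move=> ch le; rewrite /if_indep; case: ifP.
- move=> m; rewrite catrevE cats0 size_rev; exact: size_subseq (mask_subseq _ _).
Qed.

Definition sets_le thr (Hs : seq (seq 'I_N)) := all (fun A => size A <= thr) Hs.

Lemma size_combine H Hs thr : sets_le thr Hs ->
  size (combine E H Hs) <= size Hs * thr.
Proof.
rewrite /combine; elim: Hs => //= A Hs IH /andP[leA /IH{}IH].
rewrite size_cat mulSn leq_add //; apply: leq_trans (size_max_indep _) _.
by rewrite size_filter; apply: leq_trans (count_size _ _) leA.
Qed.

Definition c_combine thr := loop_cost (c_survivors + c_max_indep thr + loop_cost 0).

Lemma calls_combine H Hs thr : bounded_sets H -> thr < M ->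
  sets_le thr Hs -> size Hs < M ->
  calls f_combine (Node (ell Hs) (Node (ell H) (ell E))) (el (combine E H Hs))
    (c_combine thr).
Proof.
move=> bndH lt_thr leHs; apply: calls_loop; rewrite /combine.
elim: Hs leHs => [|A Hs IH]; rewrite !enc_simp; first by move=> _; run; lia.
move=> /= /andP[leA /IH{}IH].
have leS : size (filter (survives E H) A) <= thr.
  by rewrite size_filter; apply: leq_trans (count_size _ _) leA.
have ca1 := calls_survivors bndH (leq_ltn_trans leA lt_thr).
have le_c : c_max_indep (size (filter (survives E H) A)) <= c_max_indep thr.
  by rewrite leq_mul2l leq_exp2l // ltnS leS orbT.
have ca2 := calls_weaken (calls_max_indep (leq_ltn_trans leS lt_thr)) le_c.
set B := filter _ _ in ca1 ca2 *.
have ca3 := calls_cat et (flatten [seq max_indep E (filter (survives E H) A) [::] | A <- Hs])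
  (leq_ltn_trans (leq_trans (size_max_indep B) leS) lt_thr).
by run; lia.
Qed.

Definition c_candidate thr := c_combine thr + c_if_indep + 60.

Lemma calls_candidate H thr : bounded_sets H -> thr < M ->
  sets_le thr H -> size H * thr < M ->
  calls f_candidate (Node (ell H) (ell E)) (el (candidate E H)) (c_candidate thr).
Proof.
move=> bndH lt_thr leH ltM; rewrite /candidate /c_candidate.
have ca1 := calls_combine bndH lt_thr leH (proj1 (andP bndH)).
have ca2 := calls_if_indep (leq_ltn_trans (size_combine H leH) ltM).
by run; lia.
Qed.

Definition c_best thr k := search_cost (c_candidate thr) k.

Lemma calls_best L thr : thr < M -> sets_le thr L -> size L * thr < M -> size L < M ->
  calls f_best (Node (ell L) (Node Leaf (ell E))) (el (best E L [::]))
    (c_best thr (size L)).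
Proof.
move=> lt_thr leL lt_mul ltL.
have cand_ok H : size H <= size L -> all (fun A => size A <= thr) H ->
    size (candidate E H) < M /\
    calls f_candidate (Node (ell H) (ell E)) (el (candidate E H)) (c_candidate thr).
  move=> le_size leH.
  have ltH : size H * thr < M by apply: leq_ltn_trans lt_mul; rewrite leq_mul2r le_size orbT.
  have bndH : bounded_sets H.
    rewrite /bounded_sets (leq_ltn_trans le_size ltL) /=; apply: sub_all leH => A leA.
    exact: leq_ltn_trans leA lt_thr.
  split; last exact: calls_candidate.
  rewrite /candidate /if_indep; case: ifP => _; last exact: leq_ltn_trans ltL.
  exact: leq_ltn_trans (size_combine _ leH) ltH.
have le_size : size L + @size (seq 'I_N) [::] <= size L by rewrite addn0.
by have [] := calls_search (erefl : nth Nil prog f_best = _) cand_ok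
  le_size leL isT.
Qed.

End Edges.

Lemma calls_drop k t : calls f_drop (Node (enc_nat k) t) (drop_spine k t) (60 * k.+1).
Proof.
elim: k t => [|k IH] [|a t]; rewrite !enc_simp /=; try by run; lia.
have ca := IH t; run; lia.
Qed.

Lemma calls_sqrt fuel k t : spine t <= fuel -> k + fuel < M ->
  calls f_sqrt (Node (enc_nat k) t) (enc_nat (sqrt_loop fuel k (spine t)))
    (loop_cost (60 * M)).
Proof.
move=> le_t lt_kM; apply: (@calls_loop _ _ _ _ fuel); last by lia.
elim: fuel k t le_t lt_kM => [|m IH] k [|a t] //=; try by move=> *; run; lia.
move=> le_t lt_kM; have ca1 := calls_drop k t.
have := IH k.+1 (drop_spine k t); rewrite spine_drop enc_simp => ca2.
have {}ca2 := ca2 ltac:(lia) ltac:(lia).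
by run; nia.
Qed.

Lemma calls_gone ps V : size V < M -> size ps < M ->
  calls f_gone (Node (eparts ps) (el V)) (ell (gone ps V)) (loop_cost c_mem).
Proof.
move=> ltV; apply: calls_loop; rewrite /gone.
elim: ps => [|p ps IH]; rewrite !enc_simp; first by run; lia.
have := calls_mem p.1 ltV; rewrite /=; case: (_ \in V) => ca; rewrite ?enc_simp; run; lia.
Qed.

Definition c_lookup := loop_cost c_eq.

Lemma calls_lookup x ps o : size ps < M ->
  calls f_lookup (Node (et x) (Node (eparts ps) (el o))) (el (lookup x ps o)) c_lookup.
Proof.
apply: calls_loop; elim: ps => [|p ps IH]; rewrite !enc_simp; first by run; lia.
have := calls_eq x p.1; rewrite /=; case: (x == _) => ca; run; lia.
Qed.

Definition c_new_parts := loop_cost c_lookup.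

Lemma calls_new_parts V ps o : size ps < M -> size V < M ->
  calls f_new_parts (Node (el V) (Node (eparts ps) (el o)))
    (eparts (new_parts V ps o)) c_new_parts.
Proof.
move=> ltps; apply: calls_loop; rewrite /new_parts.
elim: V => [|x V IH]; rewrite !enc_simp; first by run; lia.
have ca := calls_lookup x o ltps; run; rewrite /=; lia.
Qed.

Lemma calls_init V : size V < M ->
  calls f_init (el V) (eparts [seq (x, [:: x]) | x <- V]) (loop_cost 0).
Proof.
apply: calls_loop; elim: V => [|x V IH]; rewrite ?map_cons !enc_simp; run; rewrite /=; lia.
Qed.

Definition c_flatten := loop_cost (loop_cost 0).

Lemma calls_flatten (L : seq (seq 'I_N)) : size L < M -> all (fun A => size A < M) L ->
  calls f_flatten (ell L) (el (flatten L)) c_flatten.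
Proof.
move=> ltL allL; apply: calls_loop ltL.
elim: L allL => [|A L IH]; rewrite !enc_simp; first by move=> _; run; lia.
move=> /= /andP[ltA /IH{}IH]; have ca := calls_cat et (flatten L) ltA.
by run; lia.
Qed.

(** Collects what the cost lemmas require of all rounds; for contraction sequences it is derived
    later from the conservation of open vertices. *)
Fixpoint rounds_bounded thr (ps : seq ('I_N * seq 'I_N)) (Vs : seq (seq 'I_N)) : bool :=
  (size ps < M) && all (fun p => size p.2 < M) ps &&
  if Vs is V :: Vs' then
    let o := flatten (gone ps V) in
    [&& size V < M, size o < M &
        rounds_bounded thr (new_parts V ps (if size o <= thr then o else [::])) Vs']
  else true.

Definition c_round := 60 + loop_cost c_mem + c_flatten + 60 * M + loop_cost 0 + c_new_parts.

Lemma calls_clusters thr ps (s : seq (trigraph 'I_N)) : 0 < M ->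
  let Vs := [seq enum (vertices H) | H <- s] in
  rounds_bounded thr ps Vs -> size s < M ->
  calls f_clusters (Node (enc_nat thr) (Node (eparts ps) (enc_seq (@enc_trigraph N) s)))
    (ell (clusters thr ps Vs)) (loop_cost c_round).
Proof.
move=> lt0M /= bnd; apply: calls_loop.
elim: s ps bnd => [|H s IH] ps /=.
  rewrite andbT => /andP[ltps _]; have ca := @calls_gone ps [::] lt0M ltps.
  by rewrite /c_round; run; lia.
set V := enum _; set o := flatten _ => /andP[/andP[ltps allps] /and3P[ltV lto /IH{}IH]].
rewrite {1}/enc_trigraph -[enc_set _ (vertices H)]/(el V).
have ca1 := calls_gone ltV ltps.
have ltg : size (gone ps V) < M.
  by rewrite size_map size_filter; apply: leq_ltn_trans (count_size _ _) ltps.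
have allg : all (fun A => size A < M) (gone ps V).
  rewrite /gone all_map; apply/allP=> p; rewrite mem_filter => /andP[_].
  exact: (allP allps).
have ca2 := calls_flatten ltg allg; rewrite -/o in ca2.
have := calls_shorter (el o) (enc_nat thr); rewrite spine_seq spine_nat.
case: ifP IH => _ IH ca3.
  by have ca4 := calls_new_parts o ltps ltV; run; rewrite /c_round; lia.
have ca4 := calls_new_parts [::] ltps ltV.
have ca5 := calls_cat el (clusters thr (new_parts V ps [::])
  [seq enum (vertices H) | H <- s]) ltg.
by rewrite enc_simp in ca4; run; rewrite /c_round; lia.
Qed.

Definition edge_lists (G : trigraph 'I_N) := 
  [seq enum e | e : {set 'I_N} <- enum (black_edges G)].

Definition approx (G : trigraph 'I_N) (s : seq (trigraph 'I_N)) : seq 'I_N :=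
  let V := enum (vertices G) in
  best (edge_lists G)
    (clusters (sqrt_loop (size V) 0 (size V)) [seq (x, [:: x]) | x <- V]
       [seq enum (vertices H) | H <- s]) [::].

Definition c_main thr k :=
  loop_cost (60 * M) + loop_cost 0 + loop_cost c_round + c_best thr k + 60.

Lemma computes_approx G s :
  let n := #|vertices G| in
  let thr := sqrt_loop n 0 n in
  let ps := [seq (x, [:: x]) | x <- enum (vertices G)] in
  let Vs := [seq enum (vertices H) | H <- s] in
  let L := clusters thr ps Vs in
  bounded_edges (edge_lists G) -> 2 < M -> n < M ->
  rounds_bounded thr ps Vs -> size s < M ->
  thr < M -> sets_le thr L -> size L * thr < M -> size L < M ->
  exists2 t, computes_in prog (enc_input G s) (el (approx G s)) t &
    t <= c_main thr (size L).
Proof.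
move=> n thr ps Vs L bndE lt2M ltnM bnd lts lt_thr leL lt_mul ltL.
suff: calls 0 (enc_input G s) (el (approx G s)) (c_main thr (size L)) by [].
rewrite /approx -cardE -/n -/thr -/ps -/Vs -/L /enc_input /enc_trigraph.
rewrite -[enc_set _ (vertices G)]/(el (enum (vertices G))).
have -> : enc_set (enc_set et) (black_edges G) = ell (edge_lists G).
  by rewrite /edge_lists -enc_seq_map.
pose V := enum (vertices G).
have sV : spine (el V) = n by rewrite spine_seq /V -cardE.
have ca1 := @calls_sqrt n 0 (el V); rewrite sV leqnn add0n in ca1.
have {}ca1 := ca1 isT ltnM; rewrite -/thr in ca1.
have ltV : size V < M by rewrite /V -cardE.
have ca2 := calls_init ltV; rewrite -/ps in ca2.
have ca3 := calls_clusters (ltnW (ltnW lt2M)) bnd lts; rewrite -/L in ca3.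
have ca4 := calls_best bndE lt2M lt_thr leL lt_mul ltL.
run; rewrite /c_main.
move: (loop_cost (60 * M)) (loop_cost 0) (loop_cost c_round) (c_best thr (size L)).
by clear; lia.
Qed.

End Cost.

(** * Clusters along a contraction sequence *)

(** While [l > 0] the hypotheses say [k (k + 1) / 2 + l = n]; only the last, truncated subtraction
    can overshoot. The first bound on [r] limits the number of clusters, the second makes [r] of
    order [sqrt n]. *)
Lemma sqrt_loop_spec fuel k l n :
  l <= fuel -> 2 * n <= k * k.+1 + 2 * l ->
  (0 < l -> k * k.+1 + 2 * l <= 2 * n) -> k * k <= 4 * n ->
  let r := sqrt_loop fuel k l in 2 * n <= r * r.+1 /\ r * r <= 4 * n.
Proof.
elim: fuel k l => [|m IH] k [|l] //= le_l lower upper le_k; try by split=> //; lia.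
have {}upper := upper isT.
by apply: IH; [lia | nia | nia | nia].
Qed.

Section Bookkeeping.
Variable T : eqType.
Implicit Types (f : T -> seq T) (V : seq T).

(** The part lists met along a contraction sequence all have this form, so a function [f] from parts
    to open sets can replace them. *)
Definition parts_of f V := [seq (x, f x) | x <- V].

Definition merged f V V' := flatten [seq f x | x <- V & x \notin V'].

Definition next_open thr f V V' x :=
  if x \in V then f x
  else if size (merged f V V') <= thr then merged f V V' else [::].

Definition closed_now thr f V V' :=
  if size (merged f V V') <= thr then [::] else [seq f x | x <- V & x \notin V'].

Lemma lookup_parts x f V o : lookup x (parts_of f V) o = if x \in V then f x else o.
Proof. by elim: V => //= y V ->; rewrite in_cons; case: eqP => [->|]. Qed.

Lemma gone_parts f V V' : gone (parts_of f V) V' = [seq f x | x <- V & x \notin V'].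
Proof. by rewrite /gone /parts_of filter_map -map_comp. Qed.

Lemma gone_all f V : gone (parts_of f V) [::] = map f V.
Proof. by rewrite gone_parts (@eq_filter _ _ predT) ?filter_predT. Qed.

Lemma new_parts_next thr f V V' :
  let o := merged f V V' in
  new_parts V' (parts_of f V) (if size o <= thr then o else [::]) =
    parts_of (next_open thr f V V') V'.
Proof. by apply: eq_map => x; rewrite lookup_parts. Qed.

Lemma clusters_cons thr f V V' Vs :
  clusters thr (parts_of f V) (V' :: Vs) =
    closed_now thr f V V' ++ clusters thr (parts_of (next_open thr f V V') V') Vs.
Proof.
rewrite -new_parts_next /= gone_parts -/(merged f V V') /closed_now.
by case: ifP.
Qed.

End Bookkeeping.

Section Sequence.
Variable N : nat.
Local Notation T := 'I_N.
Implicit Types (G H : trigraph T) (f : T -> seq T) (bag : T -> {set T}).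

Lemma black_sym G x y : black G x y = black G y x.
Proof. by rewrite /black setUC. Qed.

Lemma red_sym G x y : red_adj G x y = red_adj G y x.
Proof. by rewrite /red_adj setUC. Qed.

Lemma nonadj_sym G x y : nonadj G x y = nonadj G y x.
Proof. by rewrite /nonadj black_sym red_sym. Qed.

Definition vs H := enum (vertices H).
Lemma vs_uniq H : uniq (vs H).
Proof. exact: enum_uniq. Qed.

Arguments vs : simpl never.

Definition kept H H' := [seq x <- vs H | x \in vs H'].
Definition dropped H H' := [seq x <- vs H | x \notin vs H'].

Lemma perm_flatten_map f s t :
  perm_eq s t -> perm_eq (flatten (map f s)) (flatten (map f t)).
Proof. by move=> /(perm_map f)/perm_flatten. Qed.

(** * A single contraction *)

Section Contraction.
Variables (H H' : trigraph T) (u v w : T).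
Hypothesis con : contraction u v w H H'.

Lemma contraction_facts :
  [/\ u \in vs H, v \in vs H, u != v, w \notin vs H &
      forall x, (x \in vs H') = (x == w) || [&& x \in vs H, x != u & x != v]].
Proof.
move: con => /and5P[uH vH uv wH /andP[/eqP eqV _]].
rewrite /vs !mem_enum; split=> // x.
by rewrite !mem_enum eqV !inE negb_or; case: (x == w); rewrite //= andbC.
Qed.

Lemma mem_kept x : (x \in kept H H') = [&& x \in vs H, x != u & x != v].
Proof.
have [uH vH uv wH memH'] := contraction_facts.
rewrite mem_filter memH'; case: eqP => [->|_] /=; last by case: (x \in _); rewrite ?andbF ?andbT.
by rewrite (negbTE wH).
Qed.

Lemma perm_dropped : perm_eq (dropped H H') [:: u; v].
Proof.
have [uH vH uv wH memH'] := contraction_facts.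
apply: uniq_perm; rewrite ?(filter_uniq _ (vs_uniq _)) //= ?inE ?uv // => x.
rewrite mem_filter memH' !inE; case: (eqVneq x u) => [->|xu] /=.
  by rewrite uH andbF orbF andbT; apply: contraNneq wH => <-.
case: (eqVneq x v) => [->|xv] /=.
  by rewrite vH andbF orbF andbT; apply: contraNneq wH => <-.
by case xH: (x \in vs H); rewrite ?andbF //= orbT.
Qed.

Lemma perm_next : perm_eq (vs H') (w :: kept H H').
Proof.
have [uH vH uv wH memH'] := contraction_facts.
apply: uniq_perm; rewrite ?vs_uniq //= ?andbT.
- by rewrite (filter_uniq _ (vs_uniq _)) mem_kept (negbTE wH).
- by move=> x; rewrite memH' in_cons mem_kept.
Qed.

Lemma perm_prev : perm_eq (dropped H H' ++ kept H H') (vs H).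
Proof. by rewrite perm_catC /kept /dropped perm_filterC. Qed.

Lemma next_open_kept thr f x : x \in kept H H' ->
  next_open thr f (vs H) (vs H') x = f x.
Proof. by rewrite mem_kept /next_open => /andP[->]. Qed.

Lemma next_open_new thr f :
  next_open thr f (vs H) (vs H') w =
    if size (merged f (vs H) (vs H')) <= thr then merged f (vs H) (vs H') else [::].
Proof. by have [_ _ _ /negbTE wH _] := contraction_facts; rewrite /next_open wH. Qed.

Lemma perm_next_open thr f :
  perm_eq (flatten (map (next_open thr f (vs H) (vs H')) (vs H')))
    (next_open thr f (vs H) (vs H') w ++ flatten (map f (kept H H'))).
Proof.
apply: perm_trans (perm_flatten_map _ perm_next) _ => /=.
have /eq_in_map -> // : {in kept H H', next_open thr f (vs H) (vs H') =1 f}.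
by move=> x; apply: next_open_kept.
Qed.

(** Open vertices are conserved: those of [u] and [v] move into the new part or into the clusters
    just closed, and other parts keep theirs. *)
Lemma perm_step thr f :
  perm_eq (flatten (closed_now thr f (vs H) (vs H')) ++
           flatten (map (next_open thr f (vs H) (vs H')) (vs H')))
          (flatten (map f (vs H))).
Proof.
have := perm_next_open thr f; rewrite next_open_new => pm.
rewrite perm_sym; apply: perm_trans (_ : perm_eq _ (merged f (vs H) (vs H') ++ flatten (map f (kept H H')))) _.
  rewrite -flatten_cat -map_cat perm_flatten_map // perm_sym; exact: perm_prev.
rewrite /closed_now; case: ifP pm => _ pm; rewrite perm_sym //.
by rewrite perm_cat2l.
Qed.

(** Starting from singletons, a bag collects all original vertices contracted into a part. Unlike
    the open set it is never emptied. *)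
Definition next_bag bag x := if x == w then bag u :|: bag v else bag x.

End Contraction.

Variable G : trigraph T.

(** The partition view of a trigraph; a red edge promises nothing about the two bags. *)
Definition homogeneous H bag :=
  {in vs H &, forall x y, x != y -> {in bag x & bag y, forall a b,
     (black H x y -> black G a b) /\ (nonadj H x y -> ~~ black G a b)}}.

(** A black edge or a non-edge at [w] comes from the same relation at both [u] and [v], so it holds
    for the union of their bags. *)
Lemma homogeneous_next u v w H H' bag : contraction u v w H H' ->
  homogeneous H bag -> homogeneous H' (next_bag u v w bag).
Proof.
move=> con hom; have [uH vH uv wH memH'] := contraction_facts con.
move: (con) => /and5P[_ _ _ _ /and3P[_ /forall_inP same /forall_inP new]].
have inU x : (x \in vertices H :\: [set u; v]) = [&& x \in vs H, x != u & x != v].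
  by rewrite !inE negb_or /vs mem_enum andbC.
have homw z a b : [&& z \in vs H, z != u & z != v] ->
    a \in bag u :|: bag v -> b \in bag z ->
    (black H' w z -> black G a b) /\ (nonadj H' w z -> ~~ black G a b).
  move=> zU; have /and3P[zH zu zv] := zU; move=> ab bz.
  have := new z; rewrite inU => /(_ zU) /and3P[/eqP -> /eqP -> _].
  by case/setUP: ab => aIn; split=> /andP[h1 h2];
    [apply: (hom u z _ _ _ a b _ _).1 | apply: (hom u z _ _ _ a b _ _).2
    |apply: (hom v z _ _ _ a b _ _).1 | apply: (hom v z _ _ _ a b _ _).2];
    rewrite // eq_sym.
move=> x y; rewrite !memH' /next_bag => hx hy xy a b.
case: (eqVneq x w) hx xy => [->|xw] /= hx xy.
  move: hy; rewrite eq_sym (negbTE xy) /= => hy ha hb; exact: homw.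
case: (eqVneq y w) hy xy => [->|yw] /= hy xy.
  by rewrite black_sym nonadj_sym (black_sym G) => ha hb; apply: homw.
move=> ha hb; have := same x; rewrite inU => /(_ hx) /forall_inP /(_ y).
rewrite inU => /(_ hy) /andP[/eqP eqb /eqP eqr]; rewrite /nonadj eqb eqr.
by apply: hom => //; [case/and3P: hx | case/and3P: hy].
Qed.

Lemma path_contracts_ind (P : trigraph T -> seq (trigraph T) -> Prop) :
  (forall H, P H [::]) ->
  (forall H H' u v w s, contraction u v w H H' -> path (@contracts_to _) H' s ->
     P H' s -> P H (H' :: s)) ->
  forall H s, path (@contracts_to _) H s -> P H s.
Proof.
move=> P0 PS H s; elim: s H => //= H' s IH H /andP[/existsP[u /existsP[v /existsP[w con]]] ps].
exact: PS con ps (IH _ ps).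
Qed.

Section Threshold.
Variable thr : nat.

Definition final f H s := clusters thr (parts_of f (vs H)) (map vs s).

Lemma final_cons f H H' s :
  final f H (H' :: s) =
  closed_now thr f (vs H) (vs H') ++ final (next_open thr f (vs H) (vs H')) H' s.
Proof. exact: clusters_cons. Qed.

Lemma perm_final f H s : path (@contracts_to _) H s ->
  perm_eq (flatten (final f H s)) (flatten (map f (vs H))).
Proof.
move=> ps; elim/path_contracts_ind: H s / ps f => [H f|H H' u v w s con _ IH f].
  by rewrite /final /= gone_all.
rewrite final_cons flatten_cat; apply: perm_trans (perm_step con thr f).
by rewrite perm_cat2l IH.
Qed.

Lemma final_sizes f H s : path (@contracts_to _) H s ->
  {in vs H, forall x, size (f x) <= thr} -> sets_le thr (final f H s).
Proof.
move=> ps; elim/path_contracts_ind: H s / ps f => [H f|H H' u v w s con _ IH f] le_f.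
  by rewrite /final /= gone_all /sets_le all_map; apply/allP.
rewrite final_cons /sets_le all_cat; apply/andP; split.
  rewrite /closed_now; case: ifP => _ //; rewrite all_map; apply/allP => x.
  by rewrite mem_filter => /andP[_]; apply: le_f.
apply: IH => x _; rewrite /next_open; case: ifP => [/le_f //|_].
by case: ifP.
Qed.

(** Closing adds two clusters that together hold at least [thr.+1] vertices, which are never open
    again and pay for both; hence the factor 2. The additive term is the cluster of the last
    part. *)
Lemma size_final f H s : path (@contracts_to _) H s ->
  #|vertices (last H s)| == 1 ->
  size (final f H s) * thr.+1 <= 2 * size (flatten (map f (vs H))) + thr.+1.
Proof.
move=> ps; elim/path_contracts_ind: H s / ps f => [H f|H H' u v w s con _ IH f] /=.
  by rewrite /final /= gone_all size_map -cardE => /eqP ->; lia.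
move=> /(IH (next_open thr f (vs H) (vs H'))) {}IH.
have := perm_size (perm_step con thr f).
rewrite final_cons !size_cat; move: IH; set L := final _ _ _; set o := flatten (map (next_open _ _ _ _) _).
rewrite /closed_now; case: ifP => [_|]; first by rewrite /=; lia.
have := perm_size (perm_dropped con); rewrite /dropped size_map => -> /=.
rewrite -/(merged f (vs H) (vs H')); lia.
Qed.

Lemma final_rounds M f H s : path (@contracts_to _) H s -> N < M ->
  size (flatten (map f (vs H))) < M ->
  rounds_bounded M thr (parts_of f (vs H)) (map vs s).
Proof.
move=> ps ltNM; have lt_vs H0 : size (vs H0) < M.
  by rewrite -cardE (leq_ltn_trans (max_card _)) ?card_ord.
have first_ok f0 H0 : size (flatten (map f0 (vs H0))) < M ->
    (size (parts_of f0 (vs H0)) < M) && all (fun p => size p.2 < M) (parts_of f0 (vs H0)).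
  move=> lt; rewrite size_map lt_vs all_map; apply/allP=> x x_in /=.
  apply: leq_ltn_trans lt; rewrite size_flatten sumnE big_map big_map.
  by rewrite (big_rem x) //= leq_addr.
elim/path_contracts_ind: H s / ps f => [H f|H H' u v w s con _ IH f] lt /=.
  by rewrite first_ok.
have := perm_size (perm_step con thr f); rewrite size_cat => eq_step.
have := perm_size (perm_flatten_map f (perm_prev H H')).
rewrite map_cat flatten_cat size_cat -[flatten (map f (dropped _ _))]/(merged f (vs H) (vs H')) => eq_prev.
rewrite first_ok // lt_vs gone_parts -/(merged f (vs H) (vs H')) new_parts_next /=.
rewrite (leq_ltn_trans _ lt) /=; last by rewrite -eq_prev leq_addr.
by apply: IH; apply: leq_ltn_trans lt; rewrite -eq_step leq_addl.
Qed.

End Threshold.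
End Sequence.

(** * Colouring the clusters *)

Section Colouring.
Variables (N d : nat) (G : trigraph 'I_N).
Local Notation T := 'I_N.
Implicit Types (H : trigraph T) (f : T -> seq T) (bag : T -> {set T}).
Implicit Types (A B : seq T) (L : seq (seq T)) (col : T -> 'I_d.+1).

(** Vertices are coloured rather than clusters, so that an open set inherits the colour of the later
    cluster that absorbs it. *)
Definition monochromatic col A := {in A &, forall x y, col x = col y}.

Definition good_pair A B := {in A & B, forall a b, black G a b ->
  {in B, forall b', black G a b'} \/ {in A, forall a', black G a' b}}.

Definition good col L :=
  (forall A, A \in L -> monochromatic col A) /\
  (forall A B, A \in L -> B \in L -> A != B ->
     {in A & B, forall a b, col a = col b} -> good_pair A B).

Lemma good_pair_sym A B : good_pair A B -> good_pair B A.
Proof.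
move=> gAB b a bB aA; rewrite black_sym => /(gAB _ _ aA bB)[h|h]; [right|left] => x xIn;
  by rewrite black_sym; apply: h.
Qed.

(** A red edge has two distinct ends, so [[set u; q]] determines [q]. *)
Lemma red_neighbours H u : #|[set q | red_adj H u q]| <= red_degree H u.
Proof.
have red_neq q : red_adj H u q -> u != q.
  move=> red; have := forall_inP (trigraph_edgeP H) [set u; q].
  by rewrite inE [_ \in red_edges H]red orbT cards2 => /(_ isT) /andP[]; case: (u == q).
rewrite -(card_in_imset (f := fun q => [set u; q])); last first.
  move=> q q'; rewrite !inE => /red_neq uq _ /= eq_set.
  have := set22 u q; rewrite eq_set !inE [q == u]eq_sym (negbTE uq) /=.
  by move/eqP.
apply: subset_leq_card; apply/subsetP => e /imsetP[q]; rewrite !inE => red ->.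
by rewrite set21 andbT.
Qed.

(** [X] lists the parts being closed, [W] those that stay, and [L] the clusters closed later, all
    inside open sets of [W]. Each open set of [X] gets one colour that is absent from the red
    neighbours of its part. *)
Lemma extend_colouring H f bag X W L col :
  red_degree_le d H -> homogeneous G H bag ->
  {in vs H, forall x, {subset f x <= bag x}} ->
  {subset X ++ W <= vs H} -> uniq (flatten (map f (X ++ W))) ->
  {subset flatten L <= flatten (map f W)} ->
  good col L -> {in W, forall q, monochromatic col (f q)} ->
  exists col', good col' (map f X ++ L) /\
    {in X ++ W, forall q, monochromatic col' (f q)}.
Proof.
move=> deg hom f_bag + + subL goodL monoW.
elim: X => [|u X IH] /= sub; first by exists col.
rewrite cat_uniq => /and3P[_ /hasPn disj uniqW].
have sub1 : {subset X ++ W <= vs H} by move=> q qIn; apply: sub; rewrite inE qIn orbT.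
have uH : u \in vs H by apply: sub; rewrite inE eqxx.
have {IH sub}[col1 [[mono1 good1] monoW1]] := IH sub1 uniqW.
set L1 := map f X ++ L in mono1 good1 *.
have subL1 : {subset flatten L1 <= flatten (map f (X ++ W))}.
  move=> x; rewrite flatten_cat map_cat flatten_cat !mem_cat.
  by case/orP=> [-> //|/subL ->]; rewrite orbT.
have inL1 A x : A \in L1 -> x \in A -> exists2 q, q \in X ++ W & x \in f q.
  move=> AL xA; have /subL1/flattenP[_ /mapP[q qW ->] xq] : x \in flatten L1.
    by apply/flattenP; exists A.
  by exists q.
have not_fu q x : q \in X ++ W -> x \in f q -> x \notin f u.
  by move=> qW xq; apply: disj; apply/flattenP; exists (f q) => //; apply: map_f.
(* An open set has a single colour, read off its first element. For an empty one the default [u] may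
   add a needless colour, but at most [d] are used in any case, so one of the [d.+1] is free. *)
pose used := [set col1 (head u (f q)) | q in [set q | red_adj H u q]].
have [c c_new] : exists c, c \notin used.
  apply/existsP; apply: contraT; rewrite negb_exists => /forallP all_used.
  have : #|'I_d.+1| <= #|used| by apply/subset_leq_card/subsetP => c _; have := all_used c; rewrite negbK.
  rewrite card_ord => lt_used.
  have := forall_inP deg u; rewrite -mem_enum => /(_ uH) le_d.
  by have := leq_trans lt_used (leq_trans (leq_imset_card _ _) (leq_trans (red_neighbours H u) le_d)); rewrite ltnn.
pose col' x := if x \in f u then c else col1 x.
have col'1 q x : q \in X ++ W -> x \in f q -> col' x = col1 x.
  by move=> qW xq; rewrite /col' (negbTE (not_fu q x qW xq)).
(* Let [b] lie in the open set of [q]. The new colour excludes a red [uq]; a black one makes [b]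
   complete to [f u], and a non-edge contradicts [ab]. *)
have good_fu B : B \in L1 -> {in f u & B, forall a b, col' a = col' b} -> good_pair (f u) B.
  move=> BL col_eq a b au bB ab; have [q qW bq] := inL1 B b BL bB.
  have uq : u != q by apply: contraTneq (bq) => <-; apply: not_fu qW bq.
  have qH := sub1 q qW.
  case red: (red_adj H u q).
    have head_in : head u (f q) \in f q by case: (f q) bq => //= y s _; rewrite inE eqxx.
    case/negP: c_new; apply/imsetP; exists q; first by rewrite inE.
    have := col_eq a b au bB; rewrite (col'1 q b) // /col' au => ->.
    exact: monoW1 qW _ _ bq head_in.
  case bl: (black H u q).
    by right=> a' a'u; apply: (hom u q uH qH uq a' b _ _).1; rewrite ?bl // f_bag.
  by have := (hom u q uH qH uq a b (f_bag u uH _ au) (f_bag q qH _ bq)).2;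
     rewrite /nonadj bl red ab => /(_ isT).
exists col'; split; last first.
  move=> q; rewrite inE => /predU1P[->|qW] x y xq yq; first by rewrite /col' xq yq.
  by rewrite !(col'1 q) //; apply: monoW1 qW _ _ xq yq.
split=> [A|A B].
  rewrite inE => /predU1P[->|AL] x y xA yA; first by rewrite /col' xA yA.
  have [q qW xq] := inL1 A x AL xA; have [q' q'W yq'] := inL1 A y AL yA.
  by rewrite (col'1 q) // (col'1 q') //; apply: mono1 AL _ _ xA yA.
rewrite !inE => /predU1P[->|AL] /predU1P[->|BL]; first by rewrite eqxx.
- by move=> _; apply: good_fu.
- move=> _ col_eq; apply: good_pair_sym; apply: good_fu => // a b au bA.
  by rewrite (col_eq b a).
move=> AB col_eq; apply: good1 => // a b aA bB.
have [q qW aq] := inL1 A a AL aA; have [q' q'W bq'] := inL1 B b BL bB.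
by rewrite -(col'1 q) // -(col'1 q' b) //; apply: col_eq.
Qed.

(** Induction from the end of the sequence colours the last clusters first. The second conclusion is
    carried along because a red neighbour must block only one colour. *)
Lemma colouring_exists thr H s : path (@contracts_to _) H s ->
  forall f bag, homogeneous G H bag ->
  {in vs H, forall x, {subset f x <= bag x}} ->
  uniq (flatten (map f (vs H))) ->
  #|vertices (last H s)| == 1 -> all (red_degree_le d) (H :: s) ->
  exists col, good col (final thr f H s) /\
    {in vs H, forall q, monochromatic col (f q)}.
Proof.
move=> ps; elim/path_contracts_ind: H s / ps => [H|H H' u v w s con ps IH] f bag hom f_bag uniq_f.
  rewrite [last _ _]/= => card1 _; exists (fun=> ord0); split; last by [].
  split=> // A B; rewrite /final /= gone_all => /mapP[x xH ->] /mapP[y yH ->].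
  have [z eqz] := cards1P card1.
  by move: xH yH; rewrite /vs !mem_enum eqz !inE => /eqP-> /eqP->; rewrite eqxx.
move=> last1 /andP[deg all_deg].
set f' := next_open thr f (vs H) (vs H').
have [uH vH uv wH memH'] := contraction_facts con.
have uniq_prev : uniq (flatten (map f (dropped H H' ++ kept H H'))).
  by rewrite (perm_uniq (perm_flatten_map f (perm_prev H H'))).
have f'_new := next_open_new con thr f; rewrite -/f' in f'_new.
have f'_bag : {in vs H', forall x, {subset f' x <= next_bag u v w bag x}}.
  move=> x; rewrite memH' /next_bag; case: eqP => [-> _|_ /= xU].
    rewrite f'_new; case: ifP => _ y //; rewrite /merged.
    case/flattenP=> _ /mapP[z + ->] yz.
    rewrite -/(dropped H H') (perm_mem (perm_dropped con)) !inE => /orP[]/eqP eqz.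
      by rewrite (f_bag u uH) // -eqz.
    by rewrite (f_bag v vH) ?orbT // -eqz.
  have /andP[xH _] := xU.
  by rewrite /f' /next_open xH; apply: f_bag.
have uniq_f' : uniq (flatten (map f' (vs H'))).
  have := perm_step con thr f; move/perm_uniq; rewrite uniq_f cat_uniq.
  by case/and3P.
have [col [goodL mono]] := IH f' _ (homogeneous_next con hom) f'_bag uniq_f' last1 all_deg.
have mono_kept : {in kept H H', forall q, monochromatic col (f q)}.
  move=> q qK; rewrite -(next_open_kept con thr f qK); apply: mono.
  by rewrite (perm_mem (perm_next con)) inE qK orbT.
have mono_vs (col' : T -> 'I_d.+1) :
    {in dropped H H' ++ kept H H', forall q, monochromatic col' (f q)} ->
    {in vs H, forall q, monochromatic col' (f q)}.
  by move=> h q qH; apply: h; rewrite (perm_mem (perm_prev H H')).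
(* If the open sets are merged, no cluster is closed and both inherit the colour of the new open
   set. *)
rewrite final_cons -/f' /closed_now; case: ifP f'_new => _ f'_new.
  exists col; split=> //; apply: mono_vs => q; rewrite mem_cat => /orP[qD|]; last exact: mono_kept.
  have wH' : w \in vs H' by rewrite memH' eqxx.
  have sub : {subset f q <= f' w}.
    by move=> x xq; rewrite f'_new; apply/flattenP; exists (f q) => //; apply: map_f.
  by move=> x y /sub xq /sub yq; apply: mono wH' _ _ xq yq.
(* Otherwise the new part starts empty, so later clusters lie in the open sets of the kept parts. *)
have subL : {subset flatten (final thr f' H' s) <= flatten (map f (kept H H'))}.
  move=> x; rewrite (perm_mem (perm_final thr f' ps)) (perm_mem (perm_next_open con thr f)).
  by rewrite -/f' f'_new.
have sub_vs : {subset dropped H H' ++ kept H H' <= vs H}.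
  by move=> x; rewrite (perm_mem (perm_prev H H')).
have [col' [good' mono']] := extend_colouring deg hom f_bag sub_vs uniq_prev subL goodL mono_kept.
by exists col'; split=> //; apply: mono_vs.
Qed.

End Colouring.

(** * The approximation ratio *)

Section Correctness.
Variables (N : nat) (G : trigraph 'I_N).
Local Notation T := 'I_N.
Implicit Types (A l : seq T) (H L : seq (seq T)).
Local Notation E := (edge_lists G).

Definition stable l := {in l &, forall a b, ~~ black G a b}.

Lemma edge_card (e : {set T}) : e \in black_edges G -> #|e| = 2.
Proof.
move=> eB; have := forall_inP (trigraph_edgeP G) e.
by rewrite inE eB => /(_ isT) /andP[/eqP].
Qed.

Lemma indepP l : reflect (stable l) (indep E l).
Proof.
apply: (iffP allP) => [ind a b al bl | st e].
  apply/negP => ab; have eE : enum [set a; b] \in E.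
    by apply: (map_f (fun e : {set T} => enum e)); rewrite mem_enum.
  apply: (negP (ind _ eE)).
  by apply/allP => x; rewrite mem_enum !inE => /orP[]/eqP ->.
case/mapP=> e'; rewrite mem_enum => eB ->; apply/negP => /allP all_l.
have /eqP/cards2P[a [b [_ eq_e]]] := edge_card eB.
have := st a b; rewrite /black -eq_e eB => /(_ _ _) /negP.
by apply=> //; apply: all_l; rewrite mem_enum eq_e !inE eqxx ?orbT.
Qed.

Lemma stable_sub l l' : {subset l <= l'} -> stable l' -> stable l.
Proof. by move=> sub st a b /sub al /sub bl; apply: st. Qed.

Lemma max_indep_stable A : stable (max_indep E A [::]).
Proof.
apply: (@search_ind _ _ (if_indep E) xpredT stable) => // ch _.
by rewrite /if_indep; case: indepP.
Qed.

(** Counting occurrences serves twice in the end: the output consists of vertices of [G], and it has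
    no repetition. *)
Lemma count_max_indep A x : count_mem x (max_indep E A [::]) <= count_mem x A.
Proof.
apply: (@search_ind _ _ (if_indep E) (fun ch => count_mem x ch <= count_mem x A)
  (fun r => count_mem x r <= count_mem x A)).
- by move=> ch le; rewrite /if_indep; case: ifP.
- by move=> m; rewrite catrevE cats0 count_rev; apply: leq_count_subseq (mask_subseq _ _).
Qed.

Lemma mem_max_indep A x : x \in max_indep E A [::] -> x \in A.
Proof. by rewrite -!has_pred1 !has_count => /leq_trans; apply; apply: count_max_indep. Qed.

Lemma max_indep_ge (p : pred T) A :
  stable (filter p A) -> size (filter p A) <= size (max_indep E A [::]).
Proof.
move=> st; apply: leq_trans (search_ge (if_indep E) p A [::]).
rewrite catrevE cats0 /if_indep; case: indepP => [_|[]]; first by rewrite size_rev.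
by apply: stable_sub st => x; rewrite mem_rev.
Qed.

Lemma count_combine H Hs x : count_mem x (combine E H Hs) <= count_mem x (flatten Hs).
Proof.
rewrite /combine; elim: Hs => //= A Hs IH; rewrite !count_cat leq_add //.
apply: leq_trans (count_max_indep _ _) _; rewrite count_filter.
by apply: sub_count => y /andP[].
Qed.

Lemma candidate_stable H : stable (candidate E H).
Proof. by rewrite /candidate /if_indep; case: indepP. Qed.

Lemma count_candidate H x : count_mem x (candidate E H) <= count_mem x (flatten H).
Proof. by rewrite /candidate /if_indep; case: ifP => // _; apply: count_combine. Qed.

Lemma best_stable L : stable (best E L [::]).
Proof.
by apply: (@search_ind _ _ (candidate E) xpredT stable) => // ch _; apply: candidate_stable.
Qed.

Lemma count_best L x : count_mem x (best E L [::]) <= count_mem x (flatten L).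
Proof.
apply: (@search_ind _ _ (candidate E) (fun H => count_mem x (flatten H) <= count_mem x (flatten L))
  (fun r => count_mem x r <= count_mem x (flatten L))).
- by move=> H; apply: leq_trans (count_candidate _ _).
- move=> m; rewrite catrevE cats0 !count_flatten map_rev sumn_rev map_mask.
  elim: (map _ L) m => [|c s IH] [|[] m] //=; first by rewrite leq_add2l.
  exact: leq_trans (IH m) (leq_addl _ _).
Qed.

(** [p] marks an independent set that meets every member of [H]. All marked vertices survive, so
    each member contributes at least as many vertices as it has marked ones. *)
Lemma combine_spec H (p : pred T) :
  {in H &, forall A B, A != B -> good_pair G A B} -> all (has p) H ->
  stable (filter p (flatten H)) ->
  stable (combine E H H) /\ size (filter p (flatten H)) <= size (combine E H H).
Proof.
move=> goodH /allP meetH st.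
have p_stable A B a b : A \in H -> B \in H -> a \in A -> b \in B -> p a -> p b -> ~~ black G a b.
  move=> AH BH aA bB pa pb.
  by apply: st; rewrite mem_filter ?pa ?pb /=; apply/flattenP; [exists A | exists B].
have nonadjP B v : has_nonadj E B v -> exists2 w, w \in B & ~~ black G v w.
  by case/hasP=> w wB /indepP st'; exists w => //; apply: st'; rewrite !inE eqxx ?orbT.
have black_irr a : ~~ black G a a.
  by apply/negP => /edge_card; rewrite setUid cards1.
(* The marked vertex [w] of [B] is a non-neighbour of [v], possibly [v] itself. *)
have survive A v : A \in H -> v \in A -> p v -> survives E H v.
  move=> AH vA pv; apply/allP => B BH; have /hasP[w wB pw] := meetH B BH.
  apply/hasP; exists w => //; apply/indepP => x y; rewrite !inE.
  case/orP=> /eqP-> /orP[]/eqP->; rewrite ?black_irr //.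
  - exact: (p_stable A B).
  - exact: (p_stable B A).
split.
  move=> a b /flattenP[_ /mapP[A AH ->] aM] /flattenP[_ /mapP[B BH ->] bM].
  case: (eqVneq A B) (aM) (bM) => [<-|AB]; first exact: max_indep_stable.
  move=> /mem_max_indep; rewrite mem_filter => /andP[sa aA].
  move=> /mem_max_indep; rewrite mem_filter => /andP[sb bB].
  (* By goodness an edge would make one end complete to the cluster of the other, and that end would
     not have survived. *)
  apply/negP => ab; case: (goodH A B AH BH AB a b aA bB ab) => h.
    by have [w wB /negP[]] := nonadjP B a (allP sa B BH); apply: h.
  by have [w wA] := nonadjP A b (allP sb A AH); rewrite black_sym h.
(* The induction runs over [Hs] while survival still refers to the whole of [H]. *)
suff gen Hs : {subset Hs <= H} ->
    size (filter p (flatten Hs)) <= size (combine E H Hs) by apply: gen.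
rewrite /combine; elim: Hs => //= A Hs IH sub.
rewrite filter_cat !size_cat leq_add //; last first.
  by apply: IH => B BH; apply: sub; rewrite inE BH orbT.
have AH : A \in H by apply: sub; rewrite inE eqxx.
have -> : filter p A = filter p (filter (survives E H) A).
  rewrite -filter_predI; apply: eq_in_filter => v vA /=.
  by case pv: (p v) => //=; rewrite (survive A v AH vA pv).
apply: max_indep_ge => a b; rewrite !mem_filter => /and3P[pa _ aA] /and3P[pb _ bA].
exact: (p_stable A A).
Qed.

Lemma filter_flatten_has (p : pred T) L :
  filter p (flatten (filter (has p) L)) = filter p (flatten L).
Proof.
elim: L => //= A L IH; case: ifP; rewrite /= ?filter_cat IH //.
by rewrite has_filter => /negbFE/eqP ->.
Qed.

(** The most frequent colour has at least the average share. *)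
Lemma colour_class d (col : T -> 'I_d.+1) (I : {set T}) :
  exists j, #|I| <= d.+1 * #|[set x in I | col x == j]|.
Proof.
have [j _ max_j] := @arg_maxnP _ ord0 xpredT (fun j => #|[set x in I | col x == j]|) isT.
exists j; rewrite -sum1_card (partition_big col xpredT) //=.
rewrite -[X in X * _]card_ord -sum_nat_const; apply: leq_sum => i _.
apply: leq_trans (max_j i isT); rewrite -sum1_card; apply: eq_leq.
by apply: eq_bigl => x; rewrite inE.
Qed.

Lemma best_spec d (col : T -> 'I_d.+1) L :
  good G col L -> perm_eq (flatten L) (vs G) ->
  let r := best E L [::] in
  [/\ uniq r, {subset r <= vs G}, stable r & alpha G <= d.+1 * size r].
Proof.
move=> [mono goodL] permL r.
have count_r x : count_mem x r <= (x \in vs G).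
  by rewrite (leq_trans (count_best L x)) // (permP permL) count_uniq_mem ?vs_uniq.
split.
- apply: count_mem_uniq => x; have := count_r x; rewrite -has_pred1 has_count.
  by case: (count_mem x r) => [|[|c]]; case: (_ \in _).
- move=> x; rewrite -has_pred1 has_count => x_r; have := leq_trans x_r (count_r x).
  by case: (_ \in _).
- exact: best_stable.
rewrite /alpha; apply/bigmax_leqP => I /andP[/subsetP subI /forall_inP indI].
have [j le_j] := colour_class col I; apply: leq_trans le_j _; rewrite leq_mul2l /=.
(* Among the sets tried by the search, consider the clusters met by [J]: all of them have colour
   [j], hence they are pairwise good. *)
set J := [set x in I | col x == j]; pose p := mem J.
set H := filter (has p) L.
have sizeJ : size (filter p (flatten H)) = #|J|.
  rewrite filter_flatten_has cardE; apply: perm_size; apply: uniq_perm.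
  - by rewrite filter_uniq // (perm_uniq permL) vs_uniq.
  - exact: enum_uniq.
  move=> x; rewrite mem_filter mem_enum (perm_mem permL) /vs mem_enum /p /= !inE.
  by case xI: (x \in I); rewrite ?andbF // (subI x xI) andbT.
have stJ l : stable (filter p l).
  move=> a b; rewrite !mem_filter /p /= !inE => /andP[/andP[aI _] _] /andP[/andP[bI _] _].
  exact: (forall_inP (indI a aI)).
(* The search collects its choice in reverse order. *)
have goodH : {in rev H &, forall A B, A != B -> good_pair G A B}.
  move=> A B; rewrite !mem_rev !mem_filter => /andP[/hasP[a aA pa] AL] /andP[/hasP[b bB pb] BL] AB.
  apply: goodL => // x y xA yB.
  rewrite (mono A AL x a xA aA) (mono B BL y b yB bB).
  by move: pa pb; rewrite /p /= !inE => /andP[_ /eqP->] /andP[_ /eqP->].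
have meetH : all (has p) (rev H) by rewrite all_rev filter_all.
have [st le_size] := combine_spec goodH meetH (stJ _).
apply: leq_trans (search_ge (candidate E) (has p) L [::]).
rewrite catrevE cats0 /candidate /if_indep; case: indepP => // _.
apply: leq_trans le_size; rewrite -sizeJ; apply: eq_leq; apply: perm_size.
by apply: perm_filter; apply: perm_flatten; rewrite perm_sym perm_rev.
Qed.

End Correctness.

(** * Numerical bounds *)

Section Bounds.
Variable M : nat.
Hypothesis M_ge : 64 <= M.

(** Each loop costs two powers of [M]: one for its length, one to absorb the constant 60. [q]
    carries the exponential factor. *)
Lemma loop_cost_le q c p : 0 < q -> c <= M ^ p.+1 * q -> loop_cost M c <= M ^ p.+3 * q.
Proof.
move=> q_gt0 le_c; rewrite /loop_cost.
have le1 : M <= M ^ p.+1 * q.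
  rewrite expnS -mulnA leq_pmulr // muln_gt0 q_gt0 expn_gt0 andbT.
  by rewrite (leq_trans _ M_ge).
have -> : M ^ p.+3 * q = M * (M ^ p.+1 * q) * M by rewrite 2!expnS; lia.
rewrite leq_mul2r; apply/orP; right.
by move: (M ^ p.+1 * q) le_c le1 => X; move: M_ge; clear; nia.
Qed.

(** The factor 64 leaves room to sum several lower-order terms under one power of [M]. *)
Lemma absorb_64_pow q p1 p2 c : 0 < q -> p1 < p2 -> c <= M ^ p1 -> 64 * c <= M ^ p2 * q.
Proof.
move=> q_gt0 lt_p le_c; apply: (@leq_trans (M ^ p2)); last by rewrite leq_pmulr.
have M_gt0 : 0 < M by apply: leq_trans M_ge.
apply: (@leq_trans (M ^ p1.+1)); last by rewrite leq_pexp2l.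
by rewrite expnS leq_mul.
Qed.

(** The two searches are nested, so their costs multiply: [2 ^ k.+1] for sets of clusters,
    [2 ^ thr.+1] for subsets of one cluster. *)
Lemma cost_bound thr k :
  c_main M thr k <= M ^ 22 * 2 ^ thr.+1 * 2 ^ k.+1.
Proof.
have loop1 c p : c <= M ^ p.+1 -> loop_cost M c <= M ^ p.+3.
  by move=> le_c; have := @loop_cost_le 1 c p isT; rewrite !muln1; apply.
have le64 : 64 <= M ^ 1 by rewrite expn1.
have l0 : loop_cost M 0 <= M ^ 3 by apply: loop1.
have l60 : loop_cost M 60 <= M ^ 3 by apply: loop1; apply: leq_trans le64.
have leq : c_eq M <= M ^ 3 := l0.
have lmem : c_mem M <= M ^ 5 by apply: loop1.
have lall : c_all_mem M <= M ^ 7 by apply: loop1.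
have lind : c_indep M <= M ^ 9 by apply: loop1.
have lhas : c_has_nonadj M <= M ^ 11 by apply: loop1.
have lsur : c_survives M <= M ^ 13 by apply: loop1.
have lsurs : c_survivors M <= M ^ 15 by apply: loop1.
set q := 2 ^ thr.+1; have q_gt0 : 0 < q by rewrite expn_gt0.
have q2_gt0 : 0 < q * 2 ^ k.+1 by rewrite muln_gt0 q_gt0 expn_gt0.
have lmax : 64 * c_max_indep M thr <= M ^ 12 * q.
  rewrite /c_max_indep /search_cost -/q mulnA leq_mul2r; apply/orP; right.
  have := @absorb_64_pow 1 9 11 _ isT isT lind; have := @absorb_64_pow 1 3 11 _ isT isT l60.
  have := @absorb_64_pow 1 1 11 _ isT isT le64; rewrite !muln1 /c_if_indep expnS.
  by move: (M ^ 11) (c_indep M) (loop_cost M 60) M_ge; clear; move=> *; nia.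
have lcomb : c_combine M thr <= M ^ 19 * q.
  apply: loop_cost_le => //.
  have := absorb_64_pow q_gt0 (isT : 15 < 17) lsurs; have := absorb_64_pow q_gt0 (isT : 3 < 17) l0.
  have : 64 * c_max_indep M thr <= M ^ 17 * q.
    by apply: leq_trans lmax _; rewrite leq_mul2r leq_pexp2l ?orbT // (leq_trans _ M_ge).
  by move: (M ^ 17 * q) (c_survivors M) (c_max_indep M thr) (loop_cost M 0); clear; move=> *; lia.
have lcand : c_candidate M thr <= M ^ 20 * q.
  have := absorb_64_pow q_gt0 (isT : 9 < 19) lind; have := absorb_64_pow q_gt0 (isT : 1 < 19) le64.
  rewrite /c_candidate /c_if_indep (expnS M 19) -mulnA; move: lcomb M_ge.
  by move: (M ^ 19 * q) (c_indep M) (c_combine M thr); clear; move=> *; nia.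
have lbest : c_best M thr k <= M ^ 21 * (q * 2 ^ k.+1).
  rewrite /c_best /search_cost !mulnA leq_mul2r; apply/orP; right.
  have := absorb_64_pow q_gt0 (isT : 3 < 20) l60; have := absorb_64_pow q_gt0 (isT : 1 < 20) le64.
  rewrite (expnS M 20) -mulnA; move: lcand M_ge.
  by move: (M ^ 20 * q) (loop_cost M 60) (c_candidate M thr); clear; move=> *; nia.
have lround : c_round M <= M ^ 9.
  have lgone := loop1 _ 4 lmem.
  have lflat : c_flatten M <= M ^ 5 by apply: loop1.
  have lnew : c_new_parts M <= M ^ 7 by do 2!apply: (loop1 _ _).
  have := @absorb_64_pow 1 7 9 _ isT isT lgone; have := @absorb_64_pow 1 5 9 _ isT isT lflat.
  have := @absorb_64_pow 1 7 9 _ isT isT lnew; have := @absorb_64_pow 1 3 9 _ isT isT l0.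
  have := @absorb_64_pow 1 1 9 _ isT isT le64; have lM : 64 * M <= M ^ 2 by rewrite expnS expn1 leq_mul2r M_ge orbT.
  have := @absorb_64_pow 1 2 9 _ isT isT lM.
  rewrite !muln1 /c_round.
  by move: (M ^ 9) (loop_cost M (c_mem M)) (loop_cost M 0) (c_flatten M) (c_new_parts M); clear; move=> *; lia.
have lclus := loop1 _ 8 lround.
have lsqrt : loop_cost M (60 * M) <= M ^ 4.
  by apply: loop1; rewrite expnS expn1 leq_mul2r (leq_trans _ M_ge) ?orbT.
have := absorb_64_pow q2_gt0 (isT : 11 < 21) lclus; have := absorb_64_pow q2_gt0 (isT : 4 < 21) lsqrt.
have := absorb_64_pow q2_gt0 (isT : 3 < 21) l0; have := absorb_64_pow q2_gt0 (isT : 1 < 21) le64.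
set X := M ^ 21 * _ in lbest *.
have -> : M ^ 22 * q * 2 ^ k.+1 = M * X by rewrite -mulnA (expnS M 21) -mulnA.
have : 64 * X <= M * X by rewrite leq_mul2r M_ge orbT.
rewrite /c_main; move: X lbest (loop_cost M (60 * M)) (loop_cost M 0).
move: (loop_cost M (c_round M)) (c_best M thr k).
by clear; move=> *; lia.
Qed.

End Bounds.

(** The exponents sum to [22 (4 r + 7) + (r + 1) + (r + 2) = 90 r + 157], at most [247 r] since
    [r >= 1]. *)
Lemma total_cost n r k : 0 < r -> 2 * n <= r * r.+1 -> k <= r.+1 ->
  c_main (64 + 8 * n + 4 * n * n) r k <= 2 ^ (247 * r).
Proof.
move=> r_gt0 le_n le_k; set M := 64 + _ + _.
have M_ge : 64 <= M by rewrite /M -addnA leq_addr.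
apply: leq_trans (cost_bound M_ge r k) _.
(* As [2 n <= r (r + 1) <= 4 ^ r], the quadratic polynomial [M] is at most [128 (4 ^ r) ^ 2]. *)
have le_M : M <= 2 ^ (4 * r + 7).
  have lt_r : r.+1 <= 2 ^ r by apply: ltn_expl.
  have le_2n : 2 * n <= 2 ^ r * 2 ^ r by apply: leq_trans le_n (leq_mul (ltnW lt_r) lt_r).
  rewrite expnD (mulnC 4) expnM /M; move: (2 ^ r) lt_r le_2n => X lt_r le_2n.
  have -> : X ^ 4 * 2 ^ 7 = 128 * ((X * X) * (X * X)) by rewrite !expnS !expn0; lia.
  have : 0 < X * X by rewrite muln_gt0 !(leq_trans _ lt_r).
  by move: (X * X) le_2n => Y; clear; nia.
have le_pow : M ^ 22 <= 2 ^ ((4 * r + 7) * 22) by rewrite expnM leq_exp2r.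
apply: leq_trans (leq_mul (leq_mul le_pow (leqnn _)) (leqnn _)) _.
by rewrite -!expnD leq_exp2l //; lia.
Qed.

Lemma INR_exp2 k : INR (2 ^ k) = (2 ^ k)%coqR.
Proof. by elim: k => //= k IH; rewrite expnS mult_INR IH /=; lra. Qed.

(** Here [r <= 2 sqrt n], which doubles the constant 247. *)
Lemma time_bound n r t : r * r <= 4 * n -> t <= 2 ^ (247 * r) ->
  (INR t <= Rpower 2 (494 * sqrt (INR n)))%coqR.
Proof.
move=> le_r /leP/le_INR le_t; apply: Rle_trans le_t _.
rewrite INR_exp2 -Rpower_pow; last lra.
apply: Rle_Rpower; first lra.
rewrite mult_INR.
have sq : (INR r * INR r <= 4 * INR n)%coqR.
  by move/leP/le_INR: le_r; rewrite !mult_INR /=; lra.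
have r_ge := pos_INR r; have n_ge := pos_INR n; have s_ge := sqrt_pos (INR n).
have ss := sqrt_sqrt _ n_ge.
have le_s : (INR r <= 2 * sqrt (INR n))%coqR by nra.
have -> : INR 247 = 247%coqR by rewrite /=; lra.
by nra.
Qed.

Lemma size_sequence N (H : trigraph 'I_N) s :
  path (@contracts_to _) H s -> size s <= #|vertices H|.
Proof.
have sizeE H0 : #|vertices H0| = size (vs H0) by rewrite -cardE.
move=> ps; elim/path_contracts_ind: H s / ps => //= H H' u v w s con _.
rewrite !sizeE; have := perm_size (perm_next con); have := perm_size (perm_prev H H').
by rewrite size_cat (perm_size (perm_dropped con)) /=; lia.
Qed.

Lemma card_black_edges N (G : trigraph 'I_N) : #|black_edges G| <= N * N.
Proof.
have sub : black_edges G \subset [set [set p.1; p.2] | p : 'I_N * 'I_N].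
  apply/subsetP => e eB; have /eqP/cards2P[a [b [_ ->]]] := edge_card eB.
  by apply/imsetP; exists (a, b).
apply: leq_trans (subset_leq_card sub) (leq_trans (leq_imset_card _ _) _).
by rewrite card_prod card_ord.
Qed.

(* The labels come from 'I_(n.*2): an n-vertex graph has n vertices and its
   contraction sequence creates n - 1 new ones, so 2n labels suffice to name
   the vertices of any d-sequence of an n-vertex graph. *)
Theorem theorem1p1 (d : nat) :
  exists (c K : R) (P : program),
    (1 <= c)%coqR /\
    forall (n : nat) (G : trigraph 'I_(n.*2)) (s : seq (trigraph 'I_(n.*2))),
      is_graph G -> #|vertices G| = n -> d_sequence d G s ->
      exists (S : {set 'I_(n.*2)}) (output : tree) (t : nat),
        [/\ computes_in P (enc_input G s) output t,
            represents_set output S,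
            independent G S,
            (INR (alpha G) / c <= INR #|S|)%coqR
          & (INR t <= Rpower 2 (K * sqrt (INR n)))%coqR].
Proof.
have d1_gt0 : (0 < INR d.+1)%coqR by apply: lt_0_INR; lia.
(* The ratio is the number of colours; the program and the time constant are the same for every
   [d]. *)
exists (INR d.+1), 494%coqR, prog; split; first by apply: (le_INR 1); lia.
move=> n G s _ card_G /and3P[ps last1 deg].
have n_gt0 : 0 < n.
  rewrite -card_G; case: s ps last1 {deg} => [_ /eqP -> //|H s /= /andP[]].
  move=> /existsP[u /existsP[v /existsP[w /andP[uG _]]]] _ _.
  by apply/card_gt0P; exists u.
pose f (x : 'I_(n.*2)) := [:: x]; pose bag (x : 'I_(n.*2)) := [set x].
set r := sqrt_loop n 0 n.
have [le_n le_r] : 2 * n <= r * r.+1 /\ r * r <= 4 * n.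
  by apply: sqrt_loop_spec; lia.
have r_gt0 : 0 < r by case: r le_n {le_r} => //; lia.
have size_G : size (vs G) = n by rewrite -cardE.
have flat_f : flatten (map f (vs G)) = vs G by elim: (vs G) => //= x V ->.
set L := final r f G s.
have permL : perm_eq (flatten L) (vs G) by rewrite -[X in perm_eq _ X]flat_f; apply: perm_final.
have leL : sets_le r L by apply: final_sizes.
have size_L : size L <= r.+1.
  have := size_final r f ps last1; rewrite flat_f size_G -/L => le_L.
  rewrite -(leq_pmul2r (ltn0Sn r)); apply: leq_trans le_L _.
  by rewrite mulSn addnC leq_add2l.
have hom : homogeneous G G bag.
  by move=> x y _ _ _ a b; rewrite !inE => /eqP-> /eqP->; split=> // /andP[].
have f_bag : {in vs G, forall x, {subset f x <= bag x}}.
  by move=> x _ y; rewrite !inE.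
have uniq_f : uniq (flatten (map f (vs G))) by rewrite flat_f vs_uniq.
have [col [goodL _]] := colouring_exists r ps hom f_bag uniq_f last1 deg.
have [uniq_o sub_o stable_o le_alpha] := best_spec goodL permL.
set o := best _ _ _ in uniq_o sub_o stable_o le_alpha.
(* Exceeds all lengths that occur: at most [(2 n) ^ 2] edges, [2 n] labels, and [r (r + 1)] for the
   clusters, where [r <= 2 n]. *)
pose M := 64 + 8 * n + 4 * n * n.
have le_r2n : r <= 2 * n by nia.
have leNM : n.*2 < M by rewrite /M; lia.
have bndE : bounded_edges M (edge_lists G).
  apply/andP; split.
    rewrite size_map -cardE; apply: leq_ltn_trans (card_black_edges G) _.
    by rewrite /M -addnn; lia.
  apply/allP=> _ /mapP[e + ->]; rewrite mem_enum => /edge_card eq2.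
  by rewrite -cardE eq2 /M; lia.
have [t ev_t le_t] : exists2 t, computes_in prog (enc_input G s) (enc_seq (@enc_label _) o) t &
    t <= c_main M r (size L).
  have := @computes_approx _ M (ltnW leNM) G s; rewrite /approx -cardE card_G; apply=> //.
  - by rewrite /M; lia.
  - by apply: final_rounds; rewrite ?flat_f ?size_G // /M; lia.
  - by apply: leq_ltn_trans (size_sequence ps) _; rewrite card_G /M; lia.
  - by rewrite /M; lia.
  - by apply: leq_ltn_trans (leq_mul size_L (leqnn r)) _; rewrite /M; nia.
  - by apply: leq_ltn_trans size_L _; rewrite /M; lia.
have perm_o : perm_eq o (enum [set x in o]).
  by apply: uniq_perm; rewrite ?enum_uniq // => x; rewrite mem_enum inE.
exists [set x in o], (enc_seq (@enc_label _) o), t; split=> //.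
- by exists o.
- apply/andP; split.
    by apply/subsetP=> x; rewrite inE => /sub_o; rewrite mem_enum.
  apply/forall_inP=> x; rewrite inE => xo; apply/forall_inP=> y; rewrite inE.
  exact: stable_o.
- rewrite cardE -(perm_size perm_o).
  apply: (Rmult_le_reg_r (INR d.+1)) => //.
  rewrite /Rdiv Rmult_assoc Rinv_l ?Rmult_1_r; last lra.
  by rewrite Rmult_comm -mult_INR; apply: le_INR; apply/leP.
- by apply: time_bound le_r (leq_trans le_t (total_cost r_gt0 le_n size_L)).
Qed.
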